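(* Let $k$ be a field of characteristic zero with algebraic closure $\bar k$, let $f,g\in k[x]$ be nonconstant, and put $$m=\deg f,\quad n=\deg g,\quad e=\gcd(m,n),\quad M=\frac me,\quad N=\frac ne.$$ Let $C_{f,g}=(f(X)-g(Y)=0)_{\mathrm{red}}\subset\mathbb A^2_k$ and let $C_1,\ldots,C_s$ be the geometrically irreducible components of $C_{f,g,\bar k}$ (i.e. the irreducible components of the base change of $C_{f,g}$ to $\bar k$). For each $i$, let $D_i$ be the boundary of the affine normalization of $C_i$. Then $$\sum_{i=1}^s\#D_i=e.$$ Moreover, for every $i$ and every boundary point $P\in D_i$, $$-\mathrm{ord}_P X=N,\qquad -\mathrm{ord}_P Y=M.$$ Consequently every geometrically integral component $C_i$ satisfies $$d_X(C_i)=N\,\#D_i,\qquad d_Y(C_i)=M\,\#D_i.$$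
   Context: For a geometrically integral affine curve $C$, let $C^\nu$ be its affine normalization and $\widetilde C$ the smooth projective curve which is the projective normalization of $C$ (so $C^\nu\subset\widetilde C$ is open). The boundary is the finite set of geometric points $D_C=\widetilde C\setminus C^\nu$; here $D_i=D_{C_i}$. The coordinate functions $X,Y$ are viewed as rational functions on $\widetilde C$, $\mathrm{ord}_P$ denotes order of vanishing at $P$, and $d_X(C)=\deg(X:\widetilde C\to\mathbb P^1)$, $d_Y(C)=\deg(Y:\widetilde C\to\mathbb P^1)$. *)

(* Defs.v *)
From mathcomp Require Import all_boot all_order all_algebra.
From mathcomp Require Import boolp classical_sets functions cardinality.

Set Implicit Arguments.
Unset Strict Implicit.
Unset Printing Implicit Defensive.

Import Order.TTheory GRing.Theory Num.Theory.

Local Open Scope classical_set_scope.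
Local Open Scope ring_scope.

(* L[X, Y] is {poly {poly L}}: the outer indeterminate is Y, and the inner    *)
(* one, embedded as a constant, is X.                                         *)
Definition coordX (L : nzRingType) : {poly {poly L}} := 'X%:P.
Definition coordY (L : nzRingType) : {poly {poly L}} := 'X.

(* f(X) - g(Y) *)
Definition sep_poly (k : nzRingType) (f g : {poly k}) : {poly {poly k}} :=
  f%:P - g^:P.

(* The radical of the ideal (f(X) - g(Y)) of k[X, Y], i.e. the ideal of the   *)
(* reduced curve C_{f,g}. Ring divisibility is spelled out because the        *)
(* library's %| on polynomials over a non-field is pseudo-divisibility.       *)
Definition curve_ideal (k : fieldType) (f g : {poly k})
    : set {poly {poly k}} :=
  [set G | exists (r : nat) (h : {poly {poly k}}), G ^+ r = h * sep_poly f g].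

Definition prime_ideal (R : nzRingType) (p : {pred R}) : Prop :=
  idealr_closed p /\ prime_idealr_closed p.

Section Components.
Variables (k : fieldType) (L : closedFieldType) (iota : {rmorphism k -> L}).

(* p contains the extension to L[X, Y] of the ideal of C_{f,g}, i.e. V(p) is  *)
(* contained in the base change of C_{f,g} to L.                              *)
Definition contains_curve_ideal (f g : {poly k})
    (p : {pred {poly {poly L}}}) : Prop :=
  forall G, curve_ideal f g G -> map_poly (map_poly iota) G \in p.

(* Irreducible components of Spec A are given by the minimal primes of A.     *)
Definition components (f g : {poly k}) : set {pred {poly {poly L}}} :=
  [set p | [/\ prime_ideal p, contains_curve_ideal f g p
     & forall q : {pred {poly {poly L}}}, prime_ideal q ->
         contains_curve_ideal f g q -> {subset q <= p} -> {subset p <= q}]].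

End Components.

Section Curve.
Variables (L : closedFieldType) (K : fieldType).
Variable phi : {rmorphism {poly {poly L}} -> K}.

(* phi exhibits K as the field of fractions of L[X, Y] / p. *)
Definition is_function_field (p : {pred {poly {poly L}}}) : Prop :=
  (forall a, (phi a == 0) = (a \in p)) /\
  (forall z, exists a b, phi b != 0 /\ z = phi a / phi b).

(* The smooth projective curve with function field K is the abstract          *)
(* nonsingular curve of K / L: its points P are the discrete valuation rings  *)
(* of K / L, represented by their normalized valuations v = ord_P. The value  *)
(* at 0, which should be +oo, is fixed to be 0 so that distinct functions v   *)
(* are distinct points.                                                       *)
Definition is_point (v : K -> int) : Prop :=
  [/\ v 0 = 0,
      forall x y, x != 0 -> y != 0 -> v (x * y) = v x + v y,
      forall x y, x != 0 -> y != 0 -> x + y != 0 ->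
        Num.min (v x) (v y) <= v (x + y),
      forall c : L, c != 0 -> v (phi c%:P%:P) = 0
    & exists t, t != 0 /\ v t = 1].

(* The affine normalization is the spectrum of the integral closure of the    *)
(* coordinate ring in K; as an open subset of the projective curve, it        *)
(* consists of the points at which every element of that ring is regular.     *)
Definition affine_normalization : set (K -> int) :=
  [set v | is_point v /\ forall z, integralOver phi z -> 0 <= v z].

Definition boundary : set (K -> int) :=
  [set v | is_point v] `\` affine_normalization.

(* the subfield L(x) of K *)
Definition rational_subfield (x : K) : set K :=
  [set z | exists a b : {poly L},
     let ev (q : {poly L}) := (map_poly (fun c => phi c%:P%:P) q).[x] in
     ev b != 0 /\ z = ev a / ev b].

(* The degree of the morphism to P^1 defined by a nonconstant x in K is       *)
(* [K : L(x)]. No d satisfies this for a constant x, since K / L is infinite. *)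
Definition has_map_degree (x : K) (d : nat) : Prop :=
  exists b : 'I_d -> K, forall z, exists! c : {ffun 'I_d -> K},
    (forall j, rational_subfield x (c j)) /\ z = \sum_j c j * b j.

End Curve.

(* Main.v *)
(* Over an algebraic closure L, put W = Y^N / X^M and s = Y^t / X^u, where      *)
(* u N - t M = 1; then X = W^t / s^N and Y = W^u / s^M, and the equation         *)
(* f(X) = g(Y) becomes G(s, W) = 0 with G(0, W) = W^(t m) (a - b W^e), a and b   *)
(* being the leading coefficients of f and g. At a boundary point both X and Y   *)
(* have poles, so W is a unit, s vanishes, and W takes as value one of the e     *)
(* roots rho of a - b T^e. These roots are simple, so Hensel's lemma yields for  *)
(* each of them a unique branch W = w(s) of G = 0 through (0, rho): the order    *)
(* of vanishing along the branch is the only possible valuation, s is a          *)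
(* uniformizer, and the functions vanishing on the branch form one component.    *)
(* Hence boundary points of all components correspond to the roots rho, and      *)
(* ord X = - N, ord Y = - M at each of them. If the component C_i carries d_i of *)
(* these points and has degree n_i in Y, the leading form of its equation for    *)
(* the weights N, M has N d_i roots, so that N d_i <= n_i; summing, N e = n      *)
(* bounds the sum of the n_i, hence n_i = N d_i = [L(C_i) : L(X)]. The degree of *)
(* Y follows by exchanging the two variables.                                    *)

From HB Require Import structures.
Require Import Defs.
From mathcomp Require Import all_boot all_order all_algebra.
From mathcomp Require Import boolp classical_sets functions cardinality.
From mathcomp Require Import polyXY separable lra zify.

Set Implicit Arguments.
Unset Strict Implicit.
Unset Printing Implicit Defensive.

Import Order.TTheory GRing.Theory Num.Theory.

Local Open Scope classical_set_scope.
Local Open Scope ring_scope.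

(** * Function field of a prime ideal *)

(** Over [kbar] the components are the minimal primes over F = f(X) - g(Y) ([componentsE]), and
    everything is indexed by the [e] distinct roots rho of [branch_roots] = a - b T^e.

    A boundary point is a pole of X or Y ([boundaryP]), hence of both ([infinity_neg]). In the
    unimodular chart (s, W) the function W = Y^N / X^M is a unit there, and the chart equation at s
    = 0 forces its residue to be some rho ([exists_branch]). As rho is a simple root of that
    equation, Hensel's lemma gives a single branch through it, and [boundary_formula] expresses both
    the ideal of the component and the valuation in terms of this branch alone. Hence a root
    determines the component and the point on it; conversely [exists_branch_field] and
    [point_transport] realise every root. This bijection yields the count [e], and v(s) = 1
    ([infinity_uniformizer]) yields the two orders.

    The degrees come from a squeeze. No component is a vertical line ([minimal_prime_dominant]), so
    over L(X) the prime C_i is generated by some P_i ([dominant_generator]), whose degree in Y is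
    [K_i : L(X)] ([map_degree_coordX]). With d_i roots on C_i, the leading form of P_i gives N d_i
    <= deg_Y P_i ([leading_form_size]). The P_i are pairwise coprime divisors of F over L(X), so the
    deg_Y P_i sum to at most deg_Y F = N e, which is the sum of the N d_i; every inequality is
    therefore an equality. The degree of Y follows from the swap of X and Y. *)

Lemma fractionP (R : idomainType) (z : {fraction R}) :
  exists a b : R, b != 0 /\ z = FracField.tofrac a / FracField.tofrac b.
Proof.
elim/quotW: z => z; exists (\n_z), (\d_z).
rewrite denom_ratioP; split=> //.
apply: (canRL (mulfK _)); first by rewrite tofrac_eq0 denom_ratioP.
rewrite !piE; apply/eqmodP; rewrite /= FracField.equivfE.
by rewrite !numden_Ratio ?mulf_neq0 ?denom_ratioP ?oner_eq0 //= !mulr1 mulrC.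
Qed.

Section QuotientField.
Variables (L : closedFieldType) (p : {pred {poly {poly L}}}).
Hypothesis p_prime : prime_ideal p.

HB.instance Definition _ := isIdealr.Build {poly {poly L}} p p_prime.1.
HB.instance Definition _ :=
  isPrimeIdealrClosed.Build {poly {poly L}} p p_prime.2.

Local Notation Q := {ideal_quot p}.

(** [{fraction Q}] asks for an [idomainType], which carries a total inverse; it is chosen
    classically, and is the identity on non-units. *)
Definition quot_unit : {pred Q} := [pred x : Q | `[< exists y, y * x = 1 >]].
Definition quot_inv (x : Q) : Q :=
  if pselect (exists y, y * x = 1) is left e then projT1 (cid e) else x.

Fact quot_mulVx : {in quot_unit, left_inverse 1 quot_inv *%R}.
Proof.
move=> x /asboolP ex; rewrite /quot_inv; case: pselect => // e.
by case: (cid e).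
Qed.

Fact quot_unitPl x y : y * x = 1 -> quot_unit x.
Proof. by move=> e; apply/asboolP; exists y. Qed.

Fact quot_inv_out : {in [predC quot_unit], quot_inv =1 id}.
Proof.
by move=> x; rewrite inE => /asboolP ex; rewrite /quot_inv; case: pselect.
Qed.

HB.instance Definition _ := GRing.ComNzRing_hasMulInverse.Build Q
  quot_mulVx quot_unitPl quot_inv_out.
HB.instance Definition _ := GRing.ComUnitRing_isIntegral.Build Q
  (@Quotient.rquot_IdomainAxiom _ (PrimeIdealr.clone _ p _)).

Lemma prime_ideal_function_field :
  exists (K : fieldType) (pi : {rmorphism {poly {poly L}} -> K}),
    is_function_field pi p.
Proof.
pose pi : {rmorphism {poly {poly L}} -> {fraction Q}} :=
  (@FracField.tofrac Q) \o (\pi_Q)%qT.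
exists {fraction Q}, pi; split.
  move=> a; rewrite /pi /= tofrac_eq0.
  have := Quotient.idealrBE (PrimeIdealr.clone _ p _) a 0.
  rewrite subr0 => ->; rewrite -(rmorph0 (\pi_Q)%qT) //.
move=> z; have [a [b [b0 ->]]] := fractionP z.
by exists (repr a), (repr b); rewrite /pi /= !reprK tofrac_eq0.
Qed.

End QuotientField.

(** * Valuations at points of a curve *)

Section Points.
Variables (L : closedFieldType) (K : fieldType).
Variable phi : {rmorphism {poly {poly L}} -> K}.

Definition const_morph (c : L) : K := phi c%:P%:P.

HB.instance Definition _ :=
  GRing.RMorphism.copy const_morph (phi \o (polyC \o polyC)).

Lemma phi_polyC (q : {poly L}) :
  phi q%:P = (map_poly const_morph q).[phi (coordX L)].
Proof.
elim/poly_ind: q => [|q c IH]; first by rewrite polyC0 !rmorph0 horner0.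
rewrite polyCD polyCM !rmorphD !rmorphM /= map_polyX map_polyC /=.
by rewrite hornerMXaddC IH.
Qed.

Lemma phi_map_polyC (q : {poly L}) :
  phi q^:P = (map_poly const_morph q).[phi (coordY L)].
Proof.
elim/poly_ind: q => [|q c IH]; first by rewrite !rmorph0 horner0.
rewrite !rmorphD !rmorphM /= !map_polyX !map_polyC /=.
by rewrite hornerMXaddC IH.
Qed.

Lemma phi_expand (h : {poly {poly L}}) :
  phi h = \sum_(i < size h) phi (h`_i)%:P * phi (coordY L) ^+ i.
Proof.
rewrite -[in LHS](coefK h) poly_def rmorph_sum; apply: eq_bigr => i _.
by rewrite -mul_polyC rmorphM rmorphXn.
Qed.

Variable v : K -> int.
Hypothesis v_point : is_point phi v.

Let vM x y : x != 0 -> y != 0 -> v (x * y) = v x + v y.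
Proof. by case: v_point => _ + _ _ _; apply. Qed.

Lemma point0 : v 0 = 0. Proof. by case: v_point. Qed.

Lemma pointM x y : x != 0 -> y != 0 -> v (x * y) = v x + v y.
Proof. exact: vM. Qed.

Lemma point1 : v 1 = 0.
Proof.
have : v (1 * 1) = v 1 + v 1 := vM (oner_neq0 K) (oner_neq0 K).
by rewrite mulr1 => ?; lia.
Qed.

Lemma pointN x : v (- x) = v x.
Proof.
have [->|x0] := eqVneq x 0; first by rewrite oppr0.
have n1 : (-1 : K) != 0 by rewrite oppr_eq0 oner_neq0.
have h : v (-1 * -1) = v (-1) + v (-1) := vM n1 n1.
have hN : v (-1) = 0 by move: h; rewrite mulrNN mulr1 point1 => ?; lia.
by rewrite -[- x]mulN1r vM // hN add0r.
Qed.

Lemma pointV x : v x^-1 = - v x.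
Proof.
have [->|x0] := eqVneq x 0; first by rewrite invr0 point0.
have : v (x * x^-1) = v x + v x^-1 := vM x0 (invr_neq0 x0).
by rewrite divff // point1 => ?; lia.
Qed.

Lemma pointX x n : v (x ^+ n) = v x *+ n.
Proof.
have [->|x0] := eqVneq x 0.
  by rewrite expr0n point0 mul0rn; case: n => [|n]; rewrite ?point1 ?point0.
elim: n => [|n IH]; first by rewrite expr0 point1 mulr0n.
by rewrite exprS vM ?expf_neq0 // IH mulrS.
Qed.

Lemma point_const c : v (const_morph c) = 0.
Proof.
have [->|c0] := eqVneq c 0; first by rewrite rmorph0 point0.
by case: v_point => _ _ _ + _; apply.
Qed.

(* vge r z stands for v z >= r, with the convention v 0 = +oo *)
Definition vge (r : int) (z : K) : bool := (z == 0) || (r <= v z).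

Lemma vge0 r : vge r 0. Proof. by rewrite /vge eqxx. Qed.

Lemma vge_le r t z : t <= r -> vge r z -> vge t z.
Proof. by rewrite /vge => tr /orP[->//|H]; rewrite (le_trans tr H) orbT. Qed.

Lemma vgeP z : vge (v z) z. Proof. by rewrite /vge lexx orbT. Qed.

Lemma vge_neq0 r z : z != 0 -> vge r z = (r <= v z).
Proof. by rewrite /vge => /negPf->. Qed.

Lemma vgeD r x y : vge r x -> vge r y -> vge r (x + y).
Proof.
have [->|x0] := eqVneq x 0; first by rewrite add0r.
have [->|y0] := eqVneq y 0; first by rewrite addr0.
have [->|s0] := eqVneq (x + y) 0; first by rewrite vge0.
rewrite !vge_neq0 // => hx hy.
case: v_point => _ _ /(_ _ _ x0 y0 s0) H _ _; apply: le_trans H.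
by rewrite le_min hx hy.
Qed.

Lemma vgeN r x : vge r (- x) = vge r x.
Proof. by rewrite /vge oppr_eq0 pointN. Qed.

Lemma vgeB r x y : vge r x -> vge r y -> vge r (x - y).
Proof. by move=> hx hy; apply: vgeD; rewrite ?vgeN. Qed.

Lemma vgeM r t x y : vge r x -> vge t y -> vge (r + t) (x * y).
Proof.
have [->|x0] := eqVneq x 0; first by rewrite mul0r !vge0.
have [->|y0] := eqVneq y 0; first by rewrite mulr0 !vge0.
rewrite (vge_neq0 r x0) (vge_neq0 t y0) (vge_neq0 _ (mulf_neq0 x0 y0)) pointM //.
exact: lerD.
Qed.

Lemma vgeMl r x y : vge 0 x -> vge r y -> vge r (x * y).
Proof. by move=> hx hy; rewrite -[r]add0r; apply: vgeM. Qed.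

Lemma vgeX x n : vge 0 x -> vge 0 (x ^+ n).
Proof.
move=> hx; elim: n => [|n IH]; first by rewrite expr0 /vge point1 lexx orbT.
by rewrite exprS; apply: vgeMl.
Qed.

Lemma vge_sum (I : Type) (s : seq I) (P : pred I) F r :
  (forall i, P i -> vge r (F i)) -> vge r (\sum_(i <- s | P i) F i).
Proof.
move=> hF; elim/big_rec: _ => [|i x Pi hx]; first exact: vge0.
by apply: vgeD => //; apply: hF.
Qed.

Lemma vge_const c : vge 0 (const_morph c).
Proof. by rewrite /vge point_const lexx orbT. Qed.

Lemma vge1_const c : vge 1 (const_morph c) -> c = 0.
Proof. by rewrite /vge point_const orbF fmorph_eq0 => /eqP. Qed.

(** Nonzero elements have a finite valuation, so vanishing to every order forces zero. *)
Lemma vge_eq0 z : (forall n : nat, vge n%:Z z) -> z = 0.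
Proof.
move=> hz; apply/eqP; apply: contraT => z0.
by have := hz `|v z|.+1; rewrite vge_neq0 // => *; lia.
Qed.

(** The equality case of the ultrametric inequality: were v (x + y) larger than v x, so would be the
    valuation of x = (x + y) - y. *)
Lemma point_dominant x y : x != 0 -> vge (v x + 1) y ->
  x + y != 0 /\ v (x + y) = v x.
Proof.
move=> x0 hy.
have s0 : x + y != 0.
  apply: contraTN hy => /eqP e; rewrite -vgeN.
  by rewrite -[- y]add0r -e addrK vge_neq0 //; lia.
split=> //; have : vge (v x) (x + y).
  by apply: vgeD (vgeP _) (vge_le _ hy); lia.
rewrite vge_neq0 // => h1; apply/eqP; rewrite eq_le h1 andbT.
rewrite leNgt; apply/negP => h2.
have : vge (v x + 1) (x + y - y).
  by apply: vgeB => //; rewrite vge_neq0 // => *; lia.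
by rewrite addrK vge_neq0 //; lia.
Qed.

Lemma vge_horner (q : {poly L}) z :
  vge 0 z -> vge 0 (map_poly const_morph q).[z].
Proof.
move=> hz; elim/poly_ind: q => [|q c IH]; first by rewrite rmorph0 horner0 vge0.
rewrite rmorphD rmorphM /= map_polyX map_polyC /= hornerMXaddC.
by apply: vgeD (vge_const _); apply: vgeMl.
Qed.

(** In Horner's scheme each step multiplies by z, which has a pole, so the constant added next is
    dominated. *)
Lemma point_horner (q : {poly L}) z : v z < 0 -> q != 0 ->
  (map_poly const_morph q).[z] != 0
  /\ v (map_poly const_morph q).[z] = v z *+ (size q).-1.
Proof.
move=> vz; have z0 : z != 0 by apply: contraTneq vz => ->; rewrite point0.
elim/poly_ind: q => [|q c IH]; first by rewrite eqxx.
rewrite rmorphD rmorphM /= map_polyX map_polyC /= hornerMXaddC => qc.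
have [q0|q0] := eqVneq q 0.
  move: qc; rewrite q0 mul0r add0r rmorph0 horner0 mul0r add0r polyC_eq0 => c0.
  by rewrite point_const fmorph_eq0 c0 size_polyC c0 mulr0n.
have [H0 Hv] := IH q0.
have sq : (0 < size q)%N by rewrite size_poly_gt0.
have -> : (size (q * 'X + c%:P)).-1 = (size q).-1.+1.
  by rewrite size_MXaddC (negPf q0) /= prednK.
have HM : v ((map_poly const_morph q).[z] * z) = v z *+ (size q).-1.+1.
  by rewrite pointM // Hv mulrSr.
rewrite -HM; apply: point_dominant; first by rewrite mulf_neq0.
rewrite HM; apply: vge_le (vge_const c).
rewrite mulrS; have : v z *+ (size q).-1 <= 0 by rewrite mulrn_wle0 // ltW.
by move=> ?; lia.
Qed.

End Points.

(** * Order of vanishing along a branch *)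

Lemma horner_expansion (R : comNzRingType) (H : {poly R}) (w : R) :
  exists q, H = H.[w]%:P + q * ('X - w%:P).
Proof.
have /factor_theorem[q Hq] : root (H - H.[w]%:P) w.
  by rewrite rootE !hornerE subrr.
by exists q; rewrite -Hq addrC subrK.
Qed.

Section Order.
Variables (L : closedFieldType) (w : nat -> {poly L}).
Hypothesis w_coh : forall r, 'X^r %| w r.+1 - w r.
Implicit Types H : {poly {poly L}}.

(* w r is the truncation at order r of a power series w(s); the inner and the *)
(* outer indeterminates of H are s and W.                                     *)
Definition vanish_order_ge (r : nat) H : bool := 'X^r %| H.[w r].

Local Notation V := vanish_order_ge.

Lemma approx_coherent r t : (r <= t)%N -> 'X^r %| w t - w r.
Proof.
move=> /subnKC <-; elim: (t - r)%N => [|d IH].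
  by rewrite addn0 subrr dvdp0.
rewrite addnS -(subrK (w (r + d)) (w _.+1)) -addrA dvdp_add //.
by apply: dvdp_trans (w_coh _); rewrite dvdp_exp2l // leq_addr.
Qed.

(** The order may be tested on any later truncation, since w t - w r divides H(w t) - H(w r). This
    lets orders of different functions be compared at a common truncation. *)
Lemma vanish_orderE r t H : (r <= t)%N -> V r H = ('X^r %| H.[w t]).
Proof.
move=> rt; have [q ->] := horner_expansion H (w r).
rewrite /V !hornerE subrr mulr0 addr0.
by rewrite dvdp_addl // dvdp_mull // approx_coherent.
Qed.

Lemma vanish_order_le r t H : (r <= t)%N -> V t H -> V r H.
Proof.
move=> rt; rewrite (vanish_orderE _ rt) /V; apply: dvdp_trans.
by rewrite dvdp_exp2l.
Qed.

Lemma vanish_order0 H : V 0 H.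
Proof. by rewrite /V expr0 dvd1p. Qed.

Lemma vanish_orderD r H H' : V r H -> V r H' -> V r (H + H').
Proof. by rewrite /V hornerD; apply: dvdp_add. Qed.

Lemma vanish_orderMl r H H' : V r H' -> V r (H * H').
Proof. by rewrite /V hornerM; apply: dvdp_mull. Qed.

Lemma vanish_orderM r t H H' : V r H -> V t H' -> V (r + t) (H * H').
Proof.
rewrite (@vanish_orderE r (r + t)) ?leq_addr //.
rewrite (@vanish_orderE t (r + t)) ?leq_addl // /V hornerM exprD.
exact: dvdp_mul.
Qed.

Lemma exact_orderP r (q : {poly L}) :
  reflect (exists2 u : {poly L}, q = u * 'X^r & u.[0] != 0)
    (('X^r %| q) && ~~ ('X^(r.+1) %| q)).
Proof.
have X0 s : 'X^s != 0 :> {poly L} by rewrite monic_neq0 ?monicXn.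
apply: (iffP andP) => [[/dvdpP[u ->]]|[u -> u0]].
  rewrite exprS dvdp_mul2r // => h; exists u => //.
  by apply: contraNneq h => h; rewrite -['X]subr0 -polyC0 dvdp_XsubCl rootE h.
rewrite dvdp_mull // exprS dvdp_mul2r //; split=> //.
by rewrite -['X]subr0 -polyC0 dvdp_XsubCl rootE.
Qed.

Lemma vanish_orderM_exact r t H H' : V r H -> ~~ V r.+1 H -> V t H' ->
  ~~ V t.+1 H' -> ~~ V (r + t).+1 (H * H').
Proof.
move=> h1 h2 h3 h4.
(* Both exact orders are read at the truncation [(r + t).+1], where the unit parts can be
   multiplied. *)
have /exact_orderP[u e1 u0] :
    ('X^r %| H.[w (r + t).+1]) && ~~ ('X^(r.+1) %| H.[w (r + t).+1]).
  by rewrite -!vanish_orderE ?h1 //; lia.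
have /exact_orderP[u' e2 u0'] :
    ('X^t %| H'.[w (r + t).+1]) && ~~ ('X^(t.+1) %| H'.[w (r + t).+1]).
  by rewrite -!vanish_orderE ?h3 //; lia.
rewrite /V hornerM e1 e2.
suff /exact_orderP/andP[] : exists2 u'' : {poly L},
  u * 'X^r * (u' * 'X^t) = u'' * 'X^(r + t) & u''.[0] != 0 by [].
by exists (u * u'); rewrite ?hornerM ?mulf_neq0 // mulrACA exprD.
Qed.

Definition branch_ideal : {pred {poly {poly L}}} :=
  [pred H | `[< forall r, V r H >]].

(* The order is set to 0 on branch_ideal, where it should be infinite. *)
Definition branch_order H : nat := xget 0%N [set o | V o H && ~~ V o.+1 H].

Local Notation p := branch_ideal.
Local Notation ord := branch_order.

Lemma branch_idealP H : reflect (forall r, V r H) (H \in p).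
Proof. exact: asboolP. Qed.

Lemma branch_ideal_exact o H : V o H -> ~~ V o.+1 H ->
  H \notin p /\ ord H = o.
Proof.
move=> h1 h2; split; first by apply: contra h2 => /branch_idealP.
apply: xget_unique; first by rewrite /= h1.
move=> o' /= /andP[h1' h2']; apply/eqP; rewrite eqn_leq; apply/andP; split.
  by rewrite leqNgt; apply: contra h2 => /vanish_order_le; apply.
by rewrite leqNgt; apply: contra h2' => /vanish_order_le; apply.
Qed.

Lemma branch_orderP H : H \notin p -> V (ord H) H && ~~ V (ord H).+1 H.
Proof.
move=> Hp; have ex : exists r, ~~ V r H.
  apply: contrapT => nex; move/negP: Hp; apply; apply/branch_idealP => r.
  by apply: contrapT => h; apply: nex; exists r; apply/negP.
case: (ex_minnP ex) => -[|o]; first by rewrite vanish_order0.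
move=> h1 h2; have h3 : V o H.
  by apply: contraT => /h2; rewrite ltnn.
by have [_ ->] := branch_ideal_exact h3 h1; rewrite h3.
Qed.

Lemma branch_order_ge H r : H \notin p -> V r H -> (r <= ord H)%N.
Proof.
move=> /branch_orderP/andP[_ h] hr; rewrite leqNgt; apply: contra h.
by move=> /vanish_order_le; apply.
Qed.

Lemma branch_orderM H H' : H \notin p -> H' \notin p ->
  H * H' \notin p /\ ord (H * H') = (ord H + ord H')%N.
Proof.
move=> /branch_orderP/andP[h1 h2] /branch_orderP/andP[h3 h4].
by apply: branch_ideal_exact; [apply: vanish_orderM|apply: vanish_orderM_exact].
Qed.

Lemma branch_orderD H H' : H \notin p -> H' \notin p -> H + H' \notin p ->
  (minn (ord H) (ord H') <= ord (H + H'))%N.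
Proof.
move=> /branch_orderP/andP[h1 _] /branch_orderP/andP[h2 _] h.
apply: branch_order_ge => //; apply: vanish_orderD.
  by apply: vanish_order_le h1; rewrite geq_minl.
by apply: vanish_order_le h2; rewrite geq_minr.
Qed.

Lemma branch_order_mod H H' : H \notin p -> H' \in p ->
  H + H' \notin p /\ ord (H + H') = ord H.
Proof.
move=> /branch_orderP/andP[h1 h2] /branch_idealP h'.
apply: branch_ideal_exact; first exact: vanish_orderD.
rewrite /vanish_order_ge hornerD dvdp_addl //; exact: h'.
Qed.

Lemma branch_order_const (c : L) : c != 0 ->
  c%:P%:P \notin p /\ ord c%:P%:P = 0%N.
Proof.
move=> c0; apply: branch_ideal_exact; rewrite /V ?expr0 ?dvd1p //.
by rewrite hornerC expr1 -['X]subr0 -polyC0 dvdp_XsubCl rootE hornerC.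
Qed.

Lemma branch_order_coordX : coordX L \notin p /\ ord (coordX L) = 1%N.
Proof.
apply: branch_ideal_exact; rewrite /V /coordX hornerC ?dvdpp //.
by rewrite -[X in _ %| X]expr1 dvdp_Pexp2l ?size_polyX.
Qed.

Lemma branch_ideal_prime : prime_ideal p.
Proof.
split; [split|] => [|| a H H' /branch_idealP h /branch_idealP h'|H H'].
- by apply/branch_idealP => r; rewrite /V horner0 dvdp0.
- by have [] := branch_order_const (oner_neq0 L); rewrite !polyC1.
- apply/branch_idealP => r; apply: vanish_orderD => //.
  exact: vanish_orderMl.
- apply: contraTT; rewrite negb_or => /andP[h h'].
  by have [] := branch_orderM h h'.
Qed.

End Order.

(** * Hensel's lemma *)

Lemma horner_horner0 (R : comNzRingType) (H : {poly {poly R}}) (w : {poly R}) :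
  H.[w].[0] = H.[w.[0]%:P].[0].
Proof.
by have [q ->] := horner_expansion H w; rewrite !hornerE subrr !mulr0.
Qed.

Lemma deriv_horner_expansion (R : comNzRingType) (H q : {poly R}) (w : R) :
  H = H.[w]%:P + q * ('X - w%:P) -> H^`().[w] = q.[w].
Proof.
move/(congr1 (fun h => h^`().[w])) => ->.
by rewrite !derivE !hornerE subrr mulr0 add0r.
Qed.

Section Hensel.
Variables (L : closedFieldType) (G : {poly {poly L}}) (rho : L).

Definition hensel_slope : L := G^`().[rho%:P].[0].

(** Newton iteration with the derivative frozen at (0, rho): stage r cancels the coefficient of s^r
    in G along the branch. *)
Fixpoint hensel (r : nat) : {poly L} :=
  if r is r'.+1 then
    hensel r' - (G.[hensel r']`_r / hensel_slope) *: 'X^r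
  else rho%:P.

Hypothesis G_root : G.[rho%:P].[0] = 0.
Hypothesis G_simple : hensel_slope != 0.

Lemma hensel0 r : (hensel r).[0] = rho.
Proof.
elim: r => [|r IH] /=; first by rewrite hornerC.
by rewrite !hornerE IH expr0n mulr0 subr0.
Qed.

Lemma hensel_coherent r : 'X^r %| hensel r.+1 - hensel r.
Proof.
rewrite /= addrAC subrr sub0r dvdpNr -mul_polyC dvdp_mull //.
by rewrite dvdp_exp2l.
Qed.

(** The quotient q takes at [hensel r] the value of the derivative of G, and constant terms in s
    only see [hensel r] at s = 0, which is rho. *)
Lemma hensel_slopeE q r :
  G = G.[hensel r]%:P + q * ('X - (hensel r)%:P) ->
  q.[rho%:P].[0] = hensel_slope.
Proof.
move=> /deriv_horner_expansion e.
rewrite /hensel_slope -[in RHS](hensel0 r) -horner_horner0 e.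
by rewrite [in RHS]horner_horner0 hensel0.
Qed.

(** Writing G(w) = a s^(r+1), the correction changes the value to (a - (a(0) / slope) q(w'))
    s^(r+1), and q(w') has constant term the slope, so the bracket is divisible by s. *)
Lemma hensel_root r : 'X^(r.+1) %| G.[hensel r].
Proof.
elim: r => [|r IH].
  by rewrite expr1 -['X]subr0 -polyC0 dvdp_XsubCl rootE G_root.
have [q eG] := horner_expansion G (hensel r).
have eD := hensel_slopeE eG.
set w := hensel r in IH eG *; set w' := hensel r.+1.
have ew' : w' = w - (G.[w]`_r.+1 / hensel_slope) *: 'X^(r.+1) by [].
have /dvdpP[a ea] := IH.
have ca : G.[w]`_r.+1 = a.[0] by rewrite ea coefMXn ltnn subnn horner_coef0.
have -> : G.[w'] = (a - (a.[0] / hensel_slope) *: q.[w']) * 'X^(r.+1).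
  rewrite eG hornerD hornerM hornerC hornerXsubC ea ew' -ca addrAC subrr sub0r.
  by rewrite mulrN mulrBl -scalerAl -scalerAr.
rewrite exprS dvdp_mul2r ?monic_neq0 ?monicXn //.
rewrite -['X]subr0 -polyC0 dvdp_XsubCl rootE !hornerE horner_horner0 hensel0.
by rewrite eD divfK // subrr.
Qed.

End Hensel.

Lemma ge_min_int (x y z : int) : (Num.min x y <= z) = (x <= z) || (y <= z).
Proof. exact: ge_min. Qed.

(** * From an order function on L[X, Y] to a point of the function field *)

Section PointFromOrder.
Variables (L : closedFieldType) (K : fieldType).
Variables (phi : {rmorphism {poly {poly L}} -> K}) (p : {pred {poly {poly L}}}).
Hypothesis phi_p : is_function_field phi p.
Variable o : {poly {poly L}} -> int.
Hypothesis oM : forall a b, a \notin p -> b \notin p -> o (a * b) = o a + o b.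
Hypothesis oD : forall a b, a \notin p -> b \notin p -> a + b \notin p ->
  Num.min (o a) (o b) <= o (a + b).
Hypothesis o_mod : forall a b, a \notin p -> b \in p -> o (a + b) = o a.
Hypothesis o_const : forall c : L, c != 0 -> o c%:P%:P = 0.
Hypothesis o_surj : exists a b, [/\ a \notin p, b \notin p & o a = o b + 1].

Let phi_neq0 a : (phi a != 0) = (a \notin p).
Proof. by rewrite phi_p.1. Qed.

Let frac (z : K) : {ab | phi ab.2 != 0 /\ z = phi ab.1 / phi ab.2}.
Proof.
by apply: cid; have [a [b H]] := phi_p.2 z; exists (a, b).
Qed.

Definition point_of_order (z : K) : int :=
  if z == 0 then 0 else o (sval (frac z)).1 - o (sval (frac z)).2.

Local Notation v := point_of_order.

(** Two fractions representing the same element have cross products that differ by an element of p,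
    and [o_mod] makes their orders equal. *)
Let vE a b : a \notin p -> b \notin p -> v (phi a / phi b) = o a - o b.
Proof.
move=> ap bp; have a0 : phi a != 0 by rewrite phi_neq0.
have b0 : phi b != 0 by rewrite phi_neq0.
rewrite /v mulf_eq0 invr_eq0 (negPf a0) (negPf b0) /=.
case: (frac _) => -[c d] /= [d0 ecd].
have c0 : phi c != 0.
  apply: contraNneq (mulf_neq0 a0 (invr_neq0 b0)) => c0.
  by rewrite ecd c0 mul0r.
have e : phi (a * d) = phi (c * b).
  by rewrite !rmorphM; apply/eqP; rewrite -eqr_div // ecd.
have cp : c \notin p by rewrite -phi_neq0.
have dp : d \notin p by rewrite -phi_neq0.
have cbp : c * b \notin p by rewrite -phi_neq0 rmorphM mulf_neq0.
have dif : a * d - c * b \in p by rewrite -phi_p.1 rmorphB e subrr.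
have aux (i j k l : int) : i + l = k + j -> k - l = i - j by clear=> h; lia.
by apply: aux; have := o_mod cbp dif; rewrite addrC subrK !oM.
Qed.

Lemma exists_point_of_order :
  exists v, is_point phi v /\ forall a, a \notin p -> v (phi a) = o a.
Proof.
have p1 : 1 \notin p by rewrite -phi_neq0 rmorph1 oner_neq0.
have o1 : o 1 = 0 by rewrite -!polyC1 o_const ?oner_neq0.
have frac0 z : z != 0 -> exists a b, [/\ a \notin p, b \notin p & z = phi a / phi b].
  move=> z0; have [a [b [b0 e]]] := phi_p.2 z; exists a, b; split => //.
    by rewrite -phi_neq0; apply: contraNneq z0 => a0; rewrite e a0 mul0r.
  by rewrite -phi_neq0.
have vphi a : a \notin p -> v (phi a) = o a.
  by move=> ap; have := vE ap p1; rewrite rmorph1 divr1 o1 subr0.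
exists v; split=> //; split.
- by rewrite /v eqxx.
- move=> _ _ /frac0[a [b [ap bp ->]]] /frac0[c [d [cp dp ->]]].
  have acp : a * c \notin p by rewrite -phi_neq0 rmorphM mulf_neq0 ?phi_neq0.
  have bdp : b * d \notin p by rewrite -phi_neq0 rmorphM mulf_neq0 ?phi_neq0.
  by rewrite mulf_div -!rmorphM !vE // !oM // opprD addrACA.
- move=> x y /frac0[a [b [ap bp ->]]] /frac0[c [d [cp dp ->]]].
  have b0 : phi b != 0 by rewrite phi_neq0.
  have d0 : phi d != 0 by rewrite phi_neq0.
  have adp : a * d \notin p by rewrite -phi_neq0 rmorphM mulf_neq0 ?phi_neq0.
  have cbp : c * b \notin p by rewrite -phi_neq0 rmorphM mulf_neq0 ?phi_neq0.
  have bdp : b * d \notin p by rewrite -phi_neq0 rmorphM mulf_neq0 ?phi_neq0.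
  pose e := a * d + c * b.
  have -> : phi a / phi b + phi c / phi d = phi e / phi (b * d).
    by rewrite addf_div // rmorphD !rmorphM.
  move=> s0.
  have sp : e \notin p.
    by rewrite -phi_neq0; apply: contraNneq s0 => ->; rewrite mul0r.
  rewrite (vE ap bp) (vE cp dp) (vE sp bdp) (oM bp dp).
  have : Num.min (o (a * d)) (o (c * b)) <= o e by apply: oD.
  rewrite (oM ap dp) (oM cp bp) !ge_min_int.
  have aux (i j k l : int) : i + l <= k -> i - j <= k - (j + l).
    by clear=> h; lia.
  case/orP=> h; apply/orP; [left|right]; first exact: aux.
  by rewrite [o b + _]addrC; apply: aux.
- move=> c c0; rewrite vphi ?o_const // -phi_neq0.
  by rewrite (fmorph_eq0 (const_morph phi)).
have [a [b [ap bp e]]] := o_surj; exists (phi a / phi b).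
by rewrite vE // e mulf_neq0 ?invr_eq0 ?phi_neq0 //; split=> //; lia.
Qed.

End PointFromOrder.

(** * A valuation centred at a simple root is the order along the Hensel branch *)

Section PointAtBranch.
Variables (L : closedFieldType) (K : fieldType).
Variables (phi : {rmorphism {poly {poly L}} -> K}) (v : K -> int).
Hypothesis v_point : is_point phi v.
Variables (G : {poly {poly L}}) (rho : L).
Hypothesis G_root : G.[rho%:P].[0] = 0.
Hypothesis G_simple : hensel_slope G rho != 0.

Local Notation s := (phi (coordX L)).
Local Notation W := (phi (coordY L)).
Local Notation w := (hensel G rho).

Hypothesis s_gt0 : 0 < v s.
Hypothesis W_rho : vge v 1 (W - const_morph phi rho).
Hypothesis G0 : phi G = 0.

Let s_neq0 : s != 0.
Proof. by apply: contraTneq s_gt0 => ->; rewrite (point0 v_point). Qed.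

Let vge_s : vge v 0 s.
Proof. by rewrite vge_neq0 // ltW. Qed.

Let vge_C (q : {poly L}) : vge v 0 (phi q%:P).
Proof. by rewrite phi_polyC; apply: vge_horner. Qed.

Let vge_W : vge v 0 W.
Proof.
rewrite -(subrK (const_morph phi rho) W); apply: (vgeD v_point).
  exact: vge_le W_rho.
exact: vge_const.
Qed.

Let vge_phi (H : {poly {poly L}}) : vge v 0 (phi H).
Proof.
rewrite phi_expand; apply: (vge_sum v_point) => i _.
by apply: (vgeMl v_point) => //; apply: (vgeX v_point).
Qed.

Let vge_dvd r (q : {poly L}) : 'X^r %| q -> vge v (v s *+ r) (phi q%:P).
Proof.
move=> /dvdpP[u ->]; rewrite polyCM rmorphM; apply: (vgeMl v_point) => //.
by rewrite polyC_exp rmorphXn /= -(pointX v_point); apply: vgeP.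
Qed.

Let point_unit (q : {poly L}) : q.[0] != 0 ->
  phi q%:P != 0 /\ v (phi q%:P) = 0.
Proof.
move=> q0; have e : phi q%:P = const_morph phi q.[0] + phi (q - q.[0]%:P)%:P.
  by rewrite polyCB rmorphB addrC subrK.
have c0 : v (const_morph phi q.[0]) = 0 by apply: point_const.
rewrite e -[X in _ = X]c0; apply: (point_dominant v_point).
  by rewrite fmorph_eq0.
rewrite c0 add0r; apply: (@vge_le _ _ (v s *+ 1)); first by rewrite mulr1n; lia.
apply: vge_dvd; rewrite expr1 -['X]subr0 -polyC0 dvdp_XsubCl rootE.
by rewrite !hornerE subrr.
Qed.

Let approx_close r : vge v 1 (W - phi (w r)%:P).
Proof.
have -> : W - phi (w r)%:P = (W - const_morph phi rho) - phi (w r - rho%:P)%:P.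
  by rewrite polyCB rmorphB opprB addrA subrK.
apply: (vgeB v_point) => //.
apply: (@vge_le _ _ (v s *+ 1)); first by rewrite mulr1n; lia.
apply: vge_dvd; rewrite expr1 -['X]subr0 -polyC0 dvdp_XsubCl rootE.
by rewrite !hornerE hensel0 subrr.
Qed.

(** From 0 = G(W) = G(w) + q(W) (W - w), where q(W) is a unit at v because its residue is the slope:
    thus W - w is as small as G(w), which [hensel_root] controls. *)
Let approx_order r : vge v (v s *+ r.+1) (W - phi (w r)%:P).
Proof.
have [q eG] := horner_expansion G (w r).
have [q' eq] := horner_expansion q (w r).
have [u0 vu] : phi q != 0 /\ v (phi q) = 0.
  have [h0 hv] : phi q.[w r]%:P != 0 /\ v (phi q.[w r]%:P) = 0.
    by apply: point_unit; rewrite horner_horner0 hensel0 (hensel_slopeE eG).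
  rewrite {1 2}eq rmorphD -[X in _ = X]hv; apply: (point_dominant v_point) => //.
  rewrite hv add0r rmorphM; apply: (vgeMl v_point) => //.
  by rewrite rmorphB; apply: approx_close.
have e : W - phi (w r)%:P = (phi q)^-1 * - phi G.[w r]%:P.
  have := G0; rewrite {1}eG rmorphD rmorphM rmorphB => /eqP.
  rewrite addrC addr_eq0 => /eqP <-.
  by rewrite mulKf.
rewrite e; apply: (vgeMl v_point).
  by rewrite vge_neq0 ?invr_eq0 // (pointV v_point) vu oppr0.
by rewrite (vgeN v_point); apply/vge_dvd/hensel_root.
Qed.

Lemma point_branch_ge r H : vanish_order_ge w r H -> vge v (v s *+ r) (phi H).
Proof.
rewrite /vanish_order_ge => h; have [q ->] := horner_expansion H (w r).
rewrite rmorphD rmorphM rmorphB; apply: (vgeD v_point); first exact: vge_dvd.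
apply: (vgeMl v_point) => //; apply: vge_le (approx_order r).
by rewrite mulrSr; lia.
Qed.

(** Vanishing to all orders along the branch becomes an arbitrarily large valuation, because v(s) >
    0. *)
Lemma point_branch_ideal H : H \in branch_ideal w -> phi H = 0.
Proof.
move=> /branch_idealP h; apply: (@vge_eq0 _ v) => n.
apply: vge_le (point_branch_ge (h n)).
have : 0 <= (v s - 1) *+ n by rewrite mulrn_wge0 //; lia.
by rewrite mulrnBl; lia.
Qed.

(** H(W) differs from H(w) = u s^r, with u a unit at v, by a multiple of W - w; truncating one step
    past r makes this error strictly smaller. *)
Lemma point_branch_order H : H \notin branch_ideal w ->
  phi H != 0 /\ v (phi H) = v s *+ branch_order w H.
Proof.
have coh := hensel_coherent G rho.
move=> /(branch_orderP coh); set r := branch_order w H => /andP[h1 h2].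
have /exact_orderP[u eu u0] :
    ('X^r %| H.[w r.+1]) && ~~ ('X^(r.+1) %| H.[w r.+1]).
  by rewrite -(vanish_orderE coh) // h1.
have [pu0 vu] := point_unit u0.
have [q eH] := horner_expansion H (w r.+1).
have eph : phi H = phi u%:P * s ^+ r + phi q * (W - phi (w r.+1)%:P).
  by rewrite {1}eH rmorphD rmorphM rmorphB eu polyCM polyC_exp rmorphM rmorphXn.
have t0 : phi u%:P * s ^+ r != 0 by rewrite mulf_neq0 ?expf_neq0.
have vt : v (phi u%:P * s ^+ r) = v s *+ r.
  by rewrite (pointM v_point) ?expf_neq0 // vu add0r (pointX v_point).
rewrite eph -vt; apply: (point_dominant v_point) => //.
rewrite vt; apply: (vgeMl v_point) => //; apply: vge_le (approx_order r.+1).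
by rewrite !mulrSr -addrA lerD2l; clear -s_gt0; lia.
Qed.

End PointAtBranch.

(** * Coordinates at infinity *)

Lemma exists_eval (L K : fieldType) (kappa : {rmorphism L -> K}) (x y : K) :
  exists phi : {rmorphism {poly {poly L}} -> K},
    [/\ forall c, phi c%:P%:P = kappa c, phi (coordX L) = x
      & phi (coordY L) = y].
Proof.
pose psi : {rmorphism {poly L} -> K} := horner_eval x \o map_poly kappa.
pose phi : {rmorphism {poly {poly L}} -> K} := horner_eval y \o map_poly psi.
have phiC q : phi q%:P = psi q by rewrite /phi /= map_polyC /horner_eval hornerC.
exists phi; split.
- by move=> c; rewrite phiC /psi /= map_polyC /horner_eval hornerC.
- by rewrite phiC /psi /= map_polyX /horner_eval hornerX.
- by rewrite /phi /= map_polyX /horner_eval hornerX.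
Qed.

(* With W = Y ^+ N / X ^+ M and s = Y ^+ t / X ^+ u, where u * N - t * M = 1, *)
(* the monomial change of coordinates is unimodular: X = W ^+ t / s ^+ N and  *)
(* Y = W ^+ u / s ^+ M.                                                       *)
Definition monomial_chart (L : closedFieldType) (K : fieldType) (M N t u : nat)
    (phi eps : {rmorphism {poly {poly L}} -> K}) : Prop :=
  [/\ forall c, phi c%:P%:P = eps c%:P%:P,
      eps (coordX L) != 0,
      phi (coordX L) * eps (coordX L) ^+ N = eps (coordY L) ^+ t
    & phi (coordY L) * eps (coordX L) ^+ M = eps (coordY L) ^+ u].

Lemma exists_chart (L : closedFieldType) (K : fieldType) (M N t u : nat)
    (phi : {rmorphism {poly {poly L}} -> K}) :
  (u * N = t * M + 1)%N -> phi (coordX L) != 0 -> phi (coordY L) != 0 ->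
  exists eps, [/\ monomial_chart M N t u phi eps,
     eps (coordX L) = phi (coordY L) ^+ t / phi (coordX L) ^+ u
   & eps (coordY L) = phi (coordY L) ^+ N / phi (coordX L) ^+ M].
Proof.
move=> uN x0 y0; set x := phi _ in x0 *; set y := phi _ in y0 *.
have [eps [eC eX eY]] :=
  exists_eval (const_morph phi) (y ^+ t / x ^+ u) (y ^+ N / x ^+ M).
exists eps; rewrite /monomial_chart eX eY -/x -/y; split=> //; split=> //.
- by move=> c; rewrite eC.
- by rewrite mulf_neq0 ?invr_eq0 ?expf_neq0.
- rewrite !expr_div_n -!exprM mulrCA (mulnC N).
  congr (_ * _); rewrite uN addn1 exprS mulnC invfM mulrA divff // mul1r.
  by [].
- rewrite !expr_div_n -!exprM mulrA -exprS.
  by rewrite (mulnC N) uN addn1 (mulnC M).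
Qed.

Section Transform.
Variables (L : closedFieldType) (M N t u : nat).

(* This is s ^+ D * h(W ^+ t / s ^+ N, W ^+ u / s ^+ M) as soon as D is at    *)
(* least N k + M l for each monomial X ^+ k * Y ^+ l of h; otherwise the      *)
(* truncated subtraction makes it meaningless.                                *)
Definition transform (D : nat) (h : {poly {poly L}}) : {poly {poly L}} :=
  \sum_(l < size h) \sum_(k < size h`_l)
    (h`_l`_k)%:P%:P * coordX L ^+ (D - (N * k + M * l)) * 'X^(t * k + u * l).

Lemma transformE (K : fieldType) (phi eps : {rmorphism {poly {poly L}} -> K})
    (D : nat) (h : {poly {poly L}}) :
  monomial_chart M N t u phi eps ->
  (forall k l, h`_l`_k != 0 -> (N * k + M * l <= D)%N) ->
  phi h * eps (coordX L) ^+ D = eps (transform D h).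
Proof.
move=> [eC s0 eX eY] hD; rewrite phi_expand mulr_suml rmorph_sum.
apply: eq_bigr => l _; rewrite phi_polyC horner_coef size_map_poly.
rewrite !mulr_suml rmorph_sum; apply: eq_bigr => k _.
rewrite coef_map /= /const_morph eC !rmorphM !rmorphXn /=.
have [->|/hD le_D] := eqVneq (h`_l`_k) 0; first by rewrite !polyC0 !rmorph0 !mul0r.
rewrite -!mulrA; congr (_ * _); rewrite -/(coordY L).
have -> : eps (coordY L) ^+ (t * k + u * l) =
    (phi (coordX L) ^+ k * eps (coordX L) ^+ (N * k)) *
    (phi (coordY L) ^+ l * eps (coordX L) ^+ (M * l)).
  by rewrite exprD !exprM -eX -eY !exprMn.
by rewrite -[in LHS](subnKC le_D) !exprD mulrACA [RHS]mulrC -!mulrA.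
Qed.

End Transform.

Local Notation at0 := (map_poly (horner_eval 0)).

Lemma horner_at0 (L : fieldType) (H : {poly {poly L}}) (z : L) :
  H.[z%:P].[0] = (at0 H).[z].
Proof.
rewrite -[LHS]/(horner_eval 0 H.[z%:P]) -horner_map /=.
by rewrite /horner_eval hornerC.
Qed.

(** Monomials of weight below D keep a positive power of s, so s = 0 leaves the form of weight D. *)
Lemma transform_at0 (L : closedFieldType) (M N t u D : nat)
    (h : {poly {poly L}}) :
  (forall k l, h`_l`_k != 0 -> (N * k + M * l <= D)%N) ->
  at0 (transform M N t u D h) =
  \sum_(l < size h) \sum_(k < size h`_l | (N * k + M * l == D)%N)
    h`_l`_k *: 'X^(t * k + u * l).
Proof.
move=> hD; rewrite rmorph_sum; apply: eq_bigr => l _.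
rewrite rmorph_sum [RHS]big_mkcond; apply: eq_bigr => k _ /=.
rewrite !rmorphM !rmorphXn /= map_polyX !map_polyC /= /horner_eval !hornerC hornerX.
rewrite -mul_polyC; have [->|/hD le_D] := eqVneq (h`_l`_k) 0.
  by rewrite polyC0 !mul0r if_same.
rewrite -polyC_exp; case: ltngtP le_D => // [lt_D|->] _.
  by rewrite expr0n subn_eq0 leqNgt lt_D /= polyC0 mulr0 mul0r.
by rewrite subnn expr0 mulr1.
Qed.

(** * Residues at a point, and the boundary as the poles of X and Y *)

Section PointReduction.
Variables (L : closedFieldType) (K : fieldType).
Variables (phi : {rmorphism {poly {poly L}} -> K}) (v : K -> int).
Hypothesis v_point : is_point phi v.

(** Modulo the maximal ideal of v, the function s is 0, so H(s, W) is congruent to H(0, W). *)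
Lemma point_reduction (H : {poly {poly L}}) :
  0 < v (phi (coordX L)) -> vge v 0 (phi (coordY L)) ->
  vge v 1 (phi H - (map_poly (const_morph phi) (at0 H)).[phi (coordY L)]).
Proof.
move=> s_gt0 W_ge0.
have W_pow i : vge v 0 (phi (coordY L) ^+ i) by apply: (vgeX v_point).
rewrite phi_expand (@horner_coef_wide _ (size H)); last first.
  by rewrite size_map_poly size_poly.
rewrite -sumrB; apply: (vge_sum v_point) => i _.
rewrite -mulrBl mulrC; apply: (vgeMl v_point) => //.
rewrite !coef_map /= /horner_eval /const_morph -rmorphB -polyCB.
have /dvdpP[q ->] : 'X %| H`_i - ((H`_i).[0])%:P.
  by rewrite -['X]subr0 -polyC0 dvdp_XsubCl rootE !hornerE subrr.
rewrite polyCM rmorphM; apply: (vgeMl v_point).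
  rewrite phi_polyC; apply: vge_horner => //.
  by rewrite /vge ltW ?orbT.
by rewrite /vge -gtz0_ge1; apply/orP; right; exact: s_gt0.
Qed.

Lemma residue_horner (q : {poly L}) (z : K) (c : L) :
  vge v 1 (z - const_morph phi c) -> 
  vge v 1 ((map_poly (const_morph phi) q).[z] - const_morph phi q.[c]).
Proof.
move=> hz; have [q' eq] := horner_expansion q c.
rewrite {1}eq rmorphD rmorphM /= map_polyC rmorphB /= map_polyX map_polyC /=.
rewrite !hornerE addrC addKr; apply: (vgeMl v_point) => //.
apply: vge_horner => //; rewrite -(subrK (const_morph phi c) z).
apply: (vgeD v_point); last exact: vge_const.
exact: vge_le hz.
Qed.

Lemma residue_root (q : {poly L}) (z : K) (c : L) :
  vge v 1 (z - const_morph phi c) -> vge v 1 (map_poly (const_morph phi) q).[z] ->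
  q.[c] = 0.
Proof.
move=> /(residue_horner q) h1 h2; apply: (vge1_const v_point).
by rewrite -(subKr (map_poly (const_morph phi) q).[z] (const_morph phi _)); apply: (vgeB v_point).
Qed.

(** X and Y are integral over the coordinate ring. Conversely, if both are regular at v then the
    whole coordinate ring lies in the valuation ring, which is integrally closed. *)
Lemma boundaryP : boundary phi v <-> 
  v (phi (coordX L)) < 0 \/ v (phi (coordY L)) < 0.
Proof.
split=> [[_ nreg]|neg]; last first.
  split=> // -[_ reg]; case: neg => [h|h].
    by have := reg (phi (coordX L)) (integral_id _ _); rewrite leNgt h.
  by have := reg (phi (coordY L)) (integral_id _ _); rewrite leNgt h.
apply: contrapT => /not_orP[/negP hX /negP hY]; apply: nreg; split=> // z.
have vgeA h : vge v 0 (phi h).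
  rewrite phi_expand; apply: (vge_sum v_point) => i _.
  apply: (vgeMl v_point).
    by rewrite phi_polyC; apply: vge_horner => //; rewrite /vge leNgt hX orbT.
  by apply: (vgeX v_point); rewrite /vge leNgt hY orbT.
case=> q q_monic /eqP qz; rewrite leNgt; apply/negP => z_lt0.
have z0 : z != 0 by apply: contraTneq z_lt0 => ->; rewrite (point0 v_point).
move: qz; rewrite horner_coef size_map_poly_id0; last first.
  by rewrite (monicP q_monic) rmorph1 oner_neq0.
have sq : (0 < size q)%N by rewrite size_poly_gt0 monic_neq0.
rewrite -(prednK sq) big_ord_recr /= coef_map.
rewrite [X in _ + X * _](_ : _ = 1); last first.
  by rewrite -[RHS](rmorph1 phi); congr (phi _); exact: (monicP q_monic).
rewrite mul1r addrC; apply/eqP; set d := (size q).-1.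
(* If z had a pole, the top term z^d of its monic equation would dominate all others, so their sum
   could not vanish. *)
apply: (point_dominant v_point _ _).1; first by rewrite expf_neq0.
apply: (vge_sum v_point) => i _; rewrite coef_map.
apply: (vgeMl v_point); first exact: vgeA.
rewrite vge_neq0 ?expf_neq0 // !(pointX v_point).
have -> : v z *+ d = v z *+ i + v z + v z *+ (d - i.+1).
  by rewrite -mulrSr -mulrnDr subnKC.
have : v z *+ (d - i.+1) <= 0 by rewrite mulrn_wle0 // ltW.
by move=> ?; lia.
Qed.

End PointReduction.

(** * The equation f(X) = g(Y) in the chart at infinity *)

Section SepPoly.
Variables (L : closedFieldType) (M N t u e : nat) (f g : {poly L}).
Hypothesis uN : (u * N = t * M + 1)%N.
Hypothesis size_f : size f = (M * e).+1.
Hypothesis size_g : size g = (N * e).+1.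
Hypothesis M_gt0 : (0 < M)%N.
Hypothesis N_gt0 : (0 < N)%N.
Hypothesis e_neq0 : e%:R != 0 :> L.

Local Notation D := (N * (M * e))%N.

(** Both terms use the same [D], which is N deg f as well as M deg g. *)
Definition sep_chart : {poly {poly L}} :=
  transform M N t u D f%:P - transform M N t u D g^:P.

Let support_f k l : f%:P`_l`_k != 0 -> (N * k + M * l <= D)%N.
Proof.
rewrite coefC; case: l => [|l]; last by rewrite coef0 eqxx.
move=> fk; rewrite muln0 addn0 leq_mul2l; apply/orP; right.
by rewrite leqNgt; apply: contra fk => h; rewrite nth_default // size_f.
Qed.

Let support_g k l : g^:P`_l`_k != 0 -> (N * k + M * l <= D)%N.
Proof.
rewrite coef_map coefC; case: k => [|k]; last by rewrite eqxx.
move=> gl; rewrite muln0 add0n mulnCA leq_mul2l; apply/orP; right.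
by rewrite leqNgt; apply: contra gl => h; rewrite nth_default // size_g.
Qed.

Lemma sep_chartE (K : fieldType) (phi eps : {rmorphism {poly {poly L}} -> K}) :
  monomial_chart M N t u phi eps ->
  phi (sep_poly f g) * eps (coordX L) ^+ D = eps sep_chart.
Proof.
by move=> h; rewrite rmorphB mulrBl !(transformE h) // -rmorphB.
Qed.

Lemma sep_chart_at0 : at0 sep_chart =
  lead_coef f *: 'X^(t * (M * e)) - lead_coef g *: 'X^(u * (N * e)).
Proof.
have f0 : f != 0 by rewrite -size_poly_gt0 size_f.
have g0 : g != 0 by rewrite -size_poly_gt0 size_g.
rewrite rmorphB /= !transform_at0 //; congr (_ - _).
  rewrite size_polyC f0 big_ord1 coefC /=.
  have lt_m : (M * e < size f)%N by rewrite size_f.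
  rewrite (big_pred1 (Ordinal lt_m)) /=; first by rewrite muln0 addn0 /lead_coef size_f.
  move=> k /=; rewrite muln0 addn0 eqn_pmul2l //.
rewrite size_map_polyC.
have lt_n : (N * e < size g)%N by rewrite size_g.
rewrite (bigD1 (Ordinal lt_n)) //= [X in _ + X]big1 ?addr0 => [|l nl].
  have gn : g`_(N * e) = lead_coef g by rewrite /lead_coef size_g.
  have gnP : g^:P`_(N * e) = (lead_coef g)%:P by rewrite coef_map /= gn.
  rewrite gnP size_polyC lead_coef_eq0 g0 big_mkcond big_ord1 coefC /=.
  by rewrite !muln0 !add0n mulnCA eqxx.
have ck (k : nat) : g^:P`_l`_k = if k == 0%N then g`_l else 0.
  by rewrite coef_map coefC.
apply: big1 => k /eqP wt; rewrite ck.
case: eqP wt => [-> |_ _]; last by rewrite scale0r.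
rewrite muln0 add0n mulnCA => /eqP; rewrite eqn_pmul2l // => /eqP wt.
by case/eqP: nl; apply: val_inj.
Qed.

Definition branch_roots : {poly L} := (lead_coef f)%:P - lead_coef g *: 'X^e.

(** The two surviving exponents are t M e and u N e, which differ by e because u N - t M = 1. *)
Lemma sep_chart_at0_factor : at0 sep_chart = 'X^(t * (M * e)) * branch_roots.
Proof.
rewrite sep_chart_at0 /branch_roots mulrBr mulrC mul_polyC; congr (_ - _).
rewrite -scalerAr -exprD; congr (_ *: 'X^_).
by rewrite !mulnA uN mulnDl mul1n.
Qed.

Let lf : lead_coef f != 0.
Proof. by rewrite lead_coef_eq0 -size_poly_gt0 size_f. Qed.

Let lg : lead_coef g != 0.
Proof. by rewrite lead_coef_eq0 -size_poly_gt0 size_g. Qed.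

Let e_gt0 : (0 < e)%N.
Proof. by case: e e_neq0 => //; rewrite eqxx. Qed.

Lemma branch_root_neq0 rho : root branch_roots rho -> rho != 0.
Proof.
rewrite rootE /branch_roots !hornerE; apply: contraTneq => ->.
by rewrite expr0n eqn0Ngt e_gt0 mulr0 subr0.
Qed.

(** The derivative is - e b rho^(e-1); [e_neq0] is what characteristic zero supplies. *)
Lemma branch_roots_simple rho : root branch_roots rho ->
  branch_roots^`().[rho] != 0.
Proof.
move=> /branch_root_neq0 r0; rewrite /branch_roots !derivE sub0r -scaler_nat.
by rewrite !hornerE oppr_eq0 !mulf_neq0 // expf_neq0.
Qed.

Lemma sep_chart_root rho : root branch_roots rho ->
  sep_chart.[rho%:P].[0] = 0 /\ hensel_slope sep_chart rho != 0.
Proof.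
move=> rt; have := branch_roots_simple rt; have := branch_root_neq0 rt.
move/eqP: (rt) => rt0 r0 simple.
rewrite /hensel_slope !horner_at0 -deriv_map sep_chart_at0_factor.
rewrite hornerM rt0 mulr0; split=> //.
by rewrite derivM hornerD !hornerM rt0 mulr0 add0r mulf_neq0 // hornerXn expf_neq0.
Qed.

Lemma branch_roots_neq0 : branch_roots != 0.
Proof.
apply/eqP => /(congr1 (fun q : {poly L} => q.[0])) /eqP.
by rewrite /branch_roots !hornerE expr0n eqn0Ngt e_gt0 mulr0 subr0 (negPf lf).
Qed.

Lemma branch_roots_split : exists2 rs : seq L,
  size rs = e /\ uniq rs & forall rho, root branch_roots rho = (rho \in rs).
Proof.
have br : size branch_roots = e.+1.
  rewrite /branch_roots addrC size_polyDl size_polyN size_scale // size_polyXn //.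
  by rewrite size_polyC lf ltnS.
have [rs e_rs] := closed_field_poly_normal branch_roots.
have lb : lead_coef branch_roots != 0.
  by rewrite lead_coef_eq0 -size_poly_gt0 br.
have rtE rho : root branch_roots rho = (rho \in rs).
  by rewrite e_rs rootZ // root_prod_XsubC.
exists rs => //; split.
  apply/eqP; rewrite -eqSS -br e_rs size_scale //.
  by rewrite size_prod_XsubC.
rewrite -separable_prod_XsubC unlock; apply: Pdiv.ClosedField.root_coprimep => x.
rewrite root_prod_XsubC -rtE => /branch_roots_simple.
by rewrite {1}e_rs derivZ hornerZ mulf_eq0 (negPf lb).
Qed.

End SepPoly.

(** * Points at infinity *)

(** [is_point] sees the morphism only through constants, so a point may be read in either chart. *)
Lemma is_point_const (L : closedFieldType) (K : fieldType)
    (phi psi : {rmorphism {poly {poly L}} -> K}) (v : K -> int) :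
  (forall c : L, phi c%:P%:P = psi c%:P%:P) -> is_point phi v -> is_point psi v.
Proof. by move=> e [? ? ? h ?]; split=> // c /h; rewrite e. Qed.

(** A crude upper bound of all weights, which keeps the subtraction in [transform] from
    truncating. *)
Definition weight_bound (R : nzRingType) (M N : nat) (h : {poly {poly R}}) : nat :=
  N * sizeY h + M * size h.

Lemma weight_boundP (R : nzRingType) (M N : nat) (h : {poly {poly R}}) k l :
  h`_l`_k != 0 -> (N * k + M * l <= weight_bound M N h)%N.
Proof.
move=> hkl; rewrite leq_add // leq_mul2l; apply/orP; right; rewrite leqNgt.
  apply: contra hkl => lt_k; rewrite nth_default //.
  exact: leq_trans (max_size_coefXY _ _) (ltnW lt_k).
by apply: contra hkl => lt_l; rewrite (nth_default 0 (ltnW lt_l)) coef0.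
Qed.

(** Over an algebraically closed field q splits, and a product of linear factors lies in the maximal
    ideal only if one of them does. *)
Lemma residue_exists (L : closedFieldType) (K : fieldType)
    (phi : {rmorphism {poly {poly L}} -> K}) (v : K -> int)
    (v_point : is_point phi v) (q : {poly L}) (z : K) :
  q != 0 -> vge v 0 z -> vge v 1 (map_poly (const_morph phi) q).[z] ->
  exists2 c, root q c & vge v 1 (z - const_morph phi c).
Proof.
move=> q0 z0; have [rs ->] := closed_field_poly_normal q.
rewrite map_polyZ hornerZ => h.
have {}h : vge v 1 (map_poly (const_morph phi) (\prod_(c <- rs) ('X - c%:P))).[z].
  have l0 : const_morph phi (lead_coef q) != 0 by rewrite fmorph_eq0 lead_coef_eq0.
  rewrite -(mulKf l0 _.[_]); apply: (vgeMl v_point) h.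
  by rewrite /vge (pointV v_point) (point_const v_point) oppr0 lexx orbT.
suff [c c_rs hc] : exists2 c, c \in rs & vge v 1 (z - const_morph phi c).
  by exists c => //; rewrite rootZ ?lead_coef_eq0 // root_prod_XsubC.
elim: rs h => [|c rs IH].
  by rewrite big_nil rmorph1 hornerC /vge oner_eq0 (point1 v_point).
rewrite big_cons rmorphM /= hornerM rmorphB /= map_polyX map_polyC /= hornerXsubC.
have [hc _|hc h] := boolP (vge v 1 (z - const_morph phi c)).
  by exists c => //; rewrite mem_head.
have [|c' c'_rs hc'] := IH; last by exists c' => //; rewrite inE c'_rs orbT.
move: hc; rewrite /vge negb_or => /andP[zc0 vzc].
rewrite -/(vge v 1 _) -(mulKf zc0 _.[_]); apply: (vgeMl v_point) h.
have : vge v 0 (z - const_morph phi c).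
  by apply: (vgeB v_point) => //; apply: vge_const.
rewrite !vge_neq0 ?invr_eq0 // (pointV v_point) => *; lia.
Qed.

Lemma int_mul_eq1 (j k : int) : 0 < j -> 1 = j * k -> j = 1.
Proof.
move=> j_gt0 /(congr1 absz); rewrite abszM => /esym/eqP; rewrite muln_eq1.
by move=> /andP[/eqP jE _]; lia.
Qed.

Section PointsAtInfinity.
Variables (L : closedFieldType) (M N t u e : nat) (f g : {poly L}).
Hypothesis uN : (u * N = t * M + 1)%N.
Hypothesis size_f : size f = (M * e).+1.
Hypothesis size_g : size g = (N * e).+1.
Hypothesis M_gt0 : (0 < M)%N.
Hypothesis N_gt0 : (0 < N)%N.
Hypothesis e_neq0 : e%:R != 0 :> L.
Variables (K : fieldType) (phi : {rmorphism {poly {poly L}} -> K}).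
Variable p : {pred {poly {poly L}}}.
Hypothesis phi_p : is_function_field phi p.
Hypothesis curve : phi (sep_poly f g) = 0.
Variable v : K -> int.
Hypothesis v_bd : boundary phi v.

Let v_point : is_point phi v. Proof. by case: v_bd. Qed.
Local Notation x := (phi (coordX L)).
Local Notation y := (phi (coordY L)).

Let e_gt0 : (0 < e)%N.
Proof. by case: e e_neq0 => //; rewrite eqxx. Qed.

Let f0 : f != 0. Proof. by rewrite -size_poly_gt0 size_f. Qed.
Let g0 : g != 0. Proof. by rewrite -size_poly_gt0 size_g. Qed.

Let curve_xy :
  (map_poly (const_morph phi) f).[x] = (map_poly (const_morph phi) g).[y].
Proof.
by apply/eqP; rewrite -subr_eq0 -phi_polyC -phi_map_polyC -rmorphB curve.
Qed.

(** A pole of X is a pole of f(X) = g(Y), which rules out that Y is regular; the same argument works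
    with the roles exchanged. *)
Lemma infinity_neg : v x < 0 /\ v y < 0.
Proof.
have deg_neg (z : K) (d : nat) : v z < 0 -> (0 < d)%N -> v z *+ d < 0.
  by move=> h; case: d => // d _; rewrite mulrn_wlt0.
have vge_nneg z : ~~ (v z < 0) -> vge v 0 z by rewrite /vge -leNgt => ->; rewrite orbT.
have Me : (0 < M * e)%N by rewrite muln_gt0 M_gt0.
have Ne : (0 < N * e)%N by rewrite muln_gt0 N_gt0.
have [] := (boundaryP v_point).1 v_bd => h; split=> //.
- apply: contraT => /vge_nneg /(vge_horner v_point g).
  have [n0 e1] := point_horner v_point h f0.
  rewrite -curve_xy vge_neq0 // e1 size_f /= leNgt deg_neg //.
- apply: contraT => /vge_nneg /(vge_horner v_point f).
  have [n0 e1] := point_horner v_point h g0.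
  by rewrite curve_xy vge_neq0 // e1 size_g /= leNgt deg_neg.
Qed.

Let x_neq0 : x != 0.
Proof. by apply: contraTneq infinity_neg.1 => ->; rewrite (point0 v_point). Qed.

Let y_neq0 : y != 0.
Proof. by apply: contraTneq infinity_neg.2 => ->; rewrite (point0 v_point). Qed.

Lemma infinity_ratio : v x *+ M = v y *+ N.
Proof.
have [hx hy] := infinity_neg.
have [_ ex] := point_horner v_point hx f0.
have [_ ey] := point_horner v_point hy g0.
have : v x *+ (M * e) = v y *+ (N * e).
  by rewrite -[(M * e)%N]/((M * e).+1.-1) -size_f -ex curve_xy ey size_g.
rewrite !mulrnA => /eqP; rewrite -subr_eq0 -mulrnBl mulrn_eq0 eqn0Ngt e_gt0 /=.
by rewrite subr_eq0 => /eqP.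
Qed.

(* Y ^+ N / X ^+ M takes the value rho at v. *)
Definition branch_at (rho : L) : Prop :=
  vge v (v x *+ M + 1) (phi (coordY L ^+ N - rho%:P%:P * coordX L ^+ M)).

Lemma branch_atE rho :
  branch_at rho <-> vge v 1 (y ^+ N / x ^+ M - const_morph phi rho).
Proof.
have xM : x ^+ M != 0 by rewrite expf_neq0.
have e1 : phi (coordY L ^+ N - rho%:P%:P * coordX L ^+ M) =
    x ^+ M * (y ^+ N / x ^+ M - const_morph phi rho).
  by rewrite mulrBr mulrCA divff // mulr1 rmorphB rmorphM !rmorphXn (mulrC (x ^+ M)).
rewrite /branch_at e1 -(pointX v_point); split=> h.
  rewrite -(mulKf xM (_ - _)) -[1](addKr (v (x ^+ M))).
  by apply: (vgeM v_point) h; rewrite -(pointV v_point) vgeP.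
by apply: (vgeM v_point) h; rewrite vgeP.
Qed.

Variable eps : {rmorphism {poly {poly L}} -> K}.
Hypothesis chart : monomial_chart M N t u phi eps.
Hypothesis eps_X : eps (coordX L) = y ^+ t / x ^+ u.
Hypothesis eps_Y : eps (coordY L) = y ^+ N / x ^+ M.
Local Notation s := (eps (coordX L)).
Local Notation W := (eps (coordY L)).

Let eps_const c : const_morph eps c = const_morph phi c.
Proof. by case: chart => h _ _ _; rewrite /const_morph -h. Qed.

Let eps_point : is_point eps v.
Proof. by apply: is_point_const v_point => c; case: chart. Qed.

Let vW : v W = 0.
Proof.
rewrite eps_Y (pointM v_point) ?invr_eq0 ?expf_neq0 // (pointV v_point).
by rewrite !(pointX v_point) infinity_ratio subrr.
Qed.

Let vs : v s = v y *+ t - v x *+ u.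
Proof.
rewrite eps_X (pointM v_point) ?invr_eq0 ?expf_neq0 // (pointV v_point).
by rewrite !(pointX v_point).
Qed.

Let vx : v x = - (v s *+ N).
Proof.
rewrite vs mulrnBl -!mulrnA uN (mulnC t) mulrnA -infinity_ratio -mulrnA.
by rewrite (mulnC M) mulrnDr mulr1n opprB addrAC subrr add0r.
Qed.

Let vy : v y = - (v s *+ M).
Proof.
rewrite vs mulrnBl -!mulrnA (mulnC u) (mulrnA _ M u) infinity_ratio -mulrnA.
rewrite (mulnC N) uN.
by rewrite mulrnDr mulr1n opprB addrAC subrr add0r.
Qed.

Let vs_gt0 : 0 < v s.
Proof.
have := infinity_neg.1; rewrite vx oppr_lt0; apply: contraTT.
by rewrite -!leNgt => h; rewrite mulrn_wle0.
Qed.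

Let W_ge0 : vge v 0 W. Proof. by rewrite /vge vW lexx orbT. Qed.

Let chart_curve : eps (sep_chart M N t u e f g) = 0.
Proof.
by rewrite -(sep_chartE size_f size_g chart) curve mul0r.
Qed.

(** Reducing the chart equation at v gives W^(t M e) (a - b W^e) = 0 in the residue field; W being a
    unit, the second factor vanishes. *)
Lemma exists_branch : exists2 rho, root (branch_roots e f g) rho & branch_at rho.
Proof.
have := point_reduction eps_point (sep_chart M N t u e f g) vs_gt0 W_ge0.
rewrite chart_curve sub0r (vgeN eps_point) sep_chart_at0_factor //.
rewrite rmorphM /= map_polyXn hornerM hornerXn => h.
have W0 : W != 0 by rewrite eps_Y mulf_neq0 ?invr_eq0 ?expf_neq0.
have {}h : vge v 1 (map_poly (const_morph eps) (branch_roots e f g)).[W].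
  have Wt : W ^+ (t * (M * e)) != 0 by rewrite expf_neq0.
  rewrite -(mulKf Wt _.[_]); apply: (vgeMl eps_point) h.
  by rewrite /vge (pointV v_point) (pointX v_point) vW mul0rn oppr0 lexx orbT.
have b0 : branch_roots e f g != 0.
  by apply: branch_roots_neq0 size_f e_neq0.
have [rho rho_root hrho] := residue_exists eps_point b0 W_ge0 h.
by exists rho => //; apply/branch_atE; rewrite -eps_Y -eps_const.
Qed.

Variable rho : L.
Hypothesis rho_root : root (branch_roots e f g) rho.
Hypothesis rho_branch : branch_at rho.

Local Notation G := (sep_chart M N t u e f g).
Local Notation w := (hensel G rho).
Local Notation T h := (transform M N t u (weight_bound M N h) h).

Let G_root : G.[rho%:P].[0] = 0 /\ hensel_slope G rho != 0.
Proof. exact: sep_chart_root. Qed.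

Let W_rho : vge v 1 (W - const_morph eps rho).
Proof. by rewrite eps_const eps_Y; apply/branch_atE. Qed.

(** The transform of P vanishes at (s, W), hence its reduction at s = 0 vanishes at the residue rho
    of W. *)
Lemma leading_form_root D P : phi P = 0 ->
  (forall k l, P`_l`_k != 0 -> (N * k + M * l <= D)%N) ->
  root (map_poly (horner_eval 0) (transform M N t u D P)) rho.
Proof.
move=> P0 /(transformE chart); rewrite P0 mul0r => /esym TP0.
have := point_reduction eps_point (transform M N t u D P) vs_gt0 W_ge0.
rewrite TP0 sub0r (vgeN eps_point) => /(residue_root eps_point W_rho) rt.
exact/eqP.
Qed.

Let eps_ideal H : H \in branch_ideal w -> eps H = 0.
Proof.
exact: (point_branch_ideal eps_point G_root.1 G_root.2 vs_gt0 W_rho chart_curve).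
Qed.

Let eps_order H : H \notin branch_ideal w ->
  eps H != 0 /\ v (eps H) = v s *+ branch_order w H.
Proof.
exact: (point_branch_order eps_point G_root.1 G_root.2 vs_gt0 W_rho chart_curve).
Qed.

Let transform_eps h : phi h * s ^+ weight_bound M N h = eps (T h).
Proof. by apply: (transformE chart) => k l; apply: weight_boundP. Qed.

Let s_neq0 : s != 0. Proof. by case: chart. Qed.

(** The right-hand side mentions neither [K] nor [v]: the root rho alone fixes the kernel of phi,
    hence the component. *)
Lemma branch_kernel h : (phi h == 0) = (T h \in branch_ideal w).
Proof.
have -> : (phi h == 0) = (eps (T h) == 0).
  by rewrite -transform_eps mulf_eq0 [X in _ || X]expf_eq0 (negPf s_neq0) andbF orbF.
by have [/eps_ideal->|/eps_order[/negPf]] := boolP (T h \in _); rewrite ?eqxx.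
Qed.

Let order_mult h : phi h != 0 ->
  v (phi h) = v s * ((branch_order w (T h))%:Z - (weight_bound M N h)%:Z).
Proof.
move=> h0; have := h0; rewrite branch_kernel => /eps_order[_].
rewrite -transform_eps (pointM v_point) ?expf_neq0 // (pointX v_point).
by rewrite mulrBr -!natz !mulr_natr => <-; rewrite addrK.
Qed.

(** By [order_mult] every value of v is a multiple of v(s) > 0, and 1 is a value. *)
Lemma infinity_uniformizer : v s = 1.
Proof.
have [z [z0 vz]] : exists z, z != 0 /\ v z = 1 by case: v_point.
have [a [b [b0 e1]]] := phi_p.2 z.
have a0 : phi a != 0 by apply: contraNneq z0 => a0; rewrite e1 a0 mul0r.
have : 1 = v (phi a) - v (phi b).
  by rewrite -vz e1 (pointM v_point) ?invr_eq0 // (pointV v_point).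
rewrite !order_mult // -mulrBr; move: vs_gt0; set j := v s; set k := (X in _ * X).
exact: int_mul_eq1.
Qed.

Lemma branch_order_at h : phi h != 0 ->
  v (phi h) = (branch_order w (T h))%:Z - (weight_bound M N h)%:Z.
Proof. by move=> h0; rewrite order_mult // infinity_uniformizer mul1r. Qed.

Lemma infinity_orders : - v x = N%:Z /\ - v y = M%:Z.
Proof. by rewrite vx vy infinity_uniformizer !opprK !natz. Qed.

End PointsAtInfinity.

(** * Boundary points versus roots, and the leading form *)

Section Branches.
Variables (L : closedFieldType) (M N t u e : nat) (f g : {poly L}).
Hypothesis uN : (u * N = t * M + 1)%N.
Hypothesis size_f : size f = (M * e).+1.
Hypothesis size_g : size g = (N * e).+1.
Hypothesis M_gt0 : (0 < M)%N.
Hypothesis N_gt0 : (0 < N)%N.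
Hypothesis e_neq0 : e%:R != 0 :> L.

Local Notation roots := (branch_roots e f g).
Local Notation w rho := (hensel (sep_chart M N t u e f g) rho).
Local Notation T h := (transform M N t u (weight_bound M N h) h).

Section OnCurve.
Variables (K : fieldType) (phi : {rmorphism {poly {poly L}} -> K}).
Variable p : {pred {poly {poly L}}}.
Hypothesis phi_p : is_function_field phi p.
Hypothesis curve : phi (sep_poly f g) = 0.
Variable v : K -> int.
Hypothesis v_bd : boundary phi v.

Let v_point : is_point phi v. Proof. by case: v_bd. Qed.
Local Notation x := (phi (coordX L)).
Local Notation y := (phi (coordY L)).

Let x_lt0 : v x < 0.
Proof.
by have [] := infinity_neg size_f size_g M_gt0 N_gt0 e_neq0 curve v_bd.
Qed.

Let y_lt0 : v y < 0.
Proof.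
by have [] := infinity_neg size_f size_g M_gt0 N_gt0 e_neq0 curve v_bd.
Qed.

Let x_neq0 : x != 0.
Proof. by apply: contraTneq x_lt0 => ->; rewrite (point0 v_point). Qed.

Let y_neq0 : y != 0.
Proof. by apply: contraTneq y_lt0 => ->; rewrite (point0 v_point). Qed.

Lemma boundary_branch :
  [/\ - v x = N%:Z, - v y = M%:Z
    & exists2 rho, root roots rho & branch_at M N phi v rho].
Proof.
have [eps [chart eX eY]] := exists_chart uN x_neq0 y_neq0.
have br := exists_branch uN size_f size_g M_gt0 N_gt0 e_neq0 curve v_bd chart eX eY.
have [rho rt hrho] := br.
have [h1 h2] := infinity_orders uN size_f size_g M_gt0 N_gt0 e_neq0 phi_p curve
  v_bd chart eX eY rt hrho.
by split=> //; exists rho.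
Qed.

Lemma boundary_branch_unique rho rho' :
  branch_at M N phi v rho -> branch_at M N phi v rho' -> rho = rho'.
Proof.
move=> /(branch_atE size_f size_g M_gt0 N_gt0 e_neq0 curve v_bd) h1.
move=> /(branch_atE size_f size_g M_gt0 N_gt0 e_neq0 curve v_bd) h2.
apply/eqP; rewrite -subr_eq0; apply/eqP/(vge1_const v_point).
by have := vgeB v_point h2 h1; rewrite opprB addrC addrA subrK -rmorphB.
Qed.

(** This is what makes the map from boundary points to roots injective, across all components at
    once: both formulas depend on rho only. *)
Lemma boundary_formula rho : root roots rho -> branch_at M N phi v rho ->
  forall h, (phi h == 0) = (T h \in branch_ideal (w rho)) /\
    (phi h != 0 ->
      v (phi h) = (branch_order (w rho) (T h))%:Z - (weight_bound M N h)%:Z).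
Proof.
have [eps [chart eX eY]] := exists_chart uN x_neq0 y_neq0.
move=> rt hrho h; split.
  exact: (branch_kernel uN size_f size_g M_gt0 N_gt0 e_neq0 curve v_bd chart eX eY).
exact: (branch_order_at uN size_f size_g M_gt0 N_gt0 e_neq0 phi_p curve v_bd
  chart eX eY).
Qed.

Lemma boundary_leading_form rho D P : branch_at M N phi v rho -> phi P = 0 ->
  (forall k l, P`_l`_k != 0 -> (N * k + M * l <= D)%N) ->
  root (at0 (transform M N t u D P)) rho.
Proof.
have [eps [chart eX eY]] := exists_chart uN x_neq0 y_neq0.
move=> hrho P0 hD.
exact (leading_form_root uN size_f size_g M_gt0 N_gt0 e_neq0 curve v_bd
  chart eX eY hrho P0 hD).
Qed.
End OnCurve.

Lemma max_weight (P : {poly {poly L}}) : P != 0 ->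
  exists D k0 l0, [/\ P`_l0`_k0 != 0, (N * k0 + M * l0 = D)%N
    & forall k l, P`_l`_k != 0 -> (N * k + M * l <= D)%N].
Proof.
move=> P0; pose Q D := `[< exists k l, P`_l`_k != 0 /\ (N * k + M * l = D)%N >].
have exQ : exists D, Q D.
  exists (N * (size (lead_coef P)).-1 + M * (size P).-1)%N.
  apply/asboolP; exists (size (lead_coef P)).-1, (size P).-1; split=> //.
  by rewrite -/(lead_coef P) -/(lead_coef (lead_coef P)) !lead_coef_eq0.
have ubQ D : Q D -> (D <= weight_bound M N P)%N.
  by move=> /asboolP[k [l [h <-]]]; apply: weight_boundP.
have [D /asboolP[k0 [l0 [h0 e0]]] maxD] := ex_maxnP exQ ubQ.
exists D, k0, l0; split=> // k l h; apply: maxD.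
by apply/asboolP; exists k, l.
Qed.

(* The leading form of P for the weights N, M of X, Y, dehomogenized at X = 1, *)
(* has degree at most deg_Y P, and vanishes at T whenever T ^+ N is a root of  *)
(* the reduction of the transform of P at s = 0.                               *)
Lemma leading_form_size (P : {poly {poly L}}) (rs : seq L) :
  P != 0 -> uniq rs -> 0 \notin rs ->
  (forall D rho, rho \in rs ->
    (forall k l, P`_l`_k != 0 -> (N * k + M * l <= D)%N) ->
    root (at0 (transform M N t u D P)) rho) ->
  (N * size rs < size P)%N.
Proof.
move=> P0 rs_uniq rs0 rtT.
have [D [k0 [l0 [c0 e0 maxD]]]] := max_weight P0.
pose Q := \sum_(l < size P)
  (\sum_(k < size P`_l | (N * k + M * l == D)%N) P`_l`_k) *: 'X^l.
have size_Q : (size Q <= size P)%N.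
  apply: (leq_trans (size_sum _ _ _)); apply/bigmax_leqP => l _.
  by apply: leq_trans (size_scale_leq _ _) _; rewrite size_polyXn.
have lt_l0 : (l0 < size P)%N.
  by rewrite ltnNge; apply: contra c0 => h; rewrite (nth_default 0 h) coef0.
have lt_k0 : (k0 < size (P`_l0)%R)%N.
  by rewrite ltnNge; apply: contra c0 => h; rewrite nth_default.
(* Given l, the weight determines k, so the coefficient of Q at l0 is a single coefficient of P. *)
have Q0 : Q != 0.
  apply/eqP => /(congr1 (fun q : {poly L} => q`_l0)); apply/eqP.
  rewrite coef0 coef_sum (bigD1 (Ordinal lt_l0)) //= [X in _ + X]big1 ?addr0.
    rewrite coefZ coefXn eqxx mulr1 (big_pred1 (Ordinal lt_k0)) //= => k.
    rewrite -e0 eqn_add2r eqn_pmul2l //.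
  move=> l /negPf nl; rewrite coefZ coefXn.
  by rewrite -[l0]/(nat_of_ord (Ordinal lt_l0)) eq_sym [_ == _]nl mulr0.
pose B : {poly L} := \prod_(z <- rs) ('X - z%:P).
have dvdB : B %| at0 (transform M N t u D P).
  apply: uniq_roots_dvdp; last by rewrite uniq_rootsE.
  by apply/allP => rho /rtT; apply.
(* After T is replaced by T^N, each exponent is the degree in Y plus t times the weight, which is
   constant on the leading form. *)
have expoE a b : (N * (t * a + u * b) = b + t * (N * a + M * b))%N.
  have h : (u * N * b = (t * M + 1) * b)%N by rewrite uN.
  by clear -h; nia.
have compQ : at0 (transform M N t u D P) \Po 'X^N = Q * 'X^(t * D).
  rewrite transform_at0 // /Q rmorph_sum mulr_suml; apply: eq_bigr => l _.
  rewrite rmorph_sum -scalerAl scaler_suml; apply: eq_bigr => k /eqP wt /=.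
  rewrite comp_polyZ comp_Xn_poly -exprM -exprD; congr (_ *: 'X^_).
  by rewrite -wt expoE.
(* Since 0 is not in [rs], the polynomial B(T^N) is prime to T, and the factor T^(t D) can be
   removed. *)
have BX : B \Po 'X^N %| Q.
  have : B \Po 'X^N %| Q * 'X^(t * D) by rewrite -compQ; apply: dvdp_comp_poly.
  rewrite Gauss_dvdpl // coprimep_expr // coprimepX rootE horner_comp hornerXn.
  by rewrite expr0n eqn0Ngt N_gt0 -rootE root_prod_XsubC.
have size_B : size (B \Po 'X^N) = (N * size rs).+1.
  have := dvdpN0 BX Q0; rewrite -size_poly_gt0 => /prednK <-.
  by rewrite size_comp_poly size_prod_XsubC size_polyXn /= mulnC.
by have := dvdp_leq Q0 BX; rewrite size_B => /leq_trans; apply.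
Qed.

End Branches.

(** Every root occurs: the field is that of the prime of functions of (s, W) vanishing on the Hensel
    branch, the point is the order along it, and psi sends X, Y to W^t / s^N, W^u / s^M. *)
Lemma exists_branch_field (L : closedFieldType) (M N t u e : nat) (f g : {poly L})
    (rho : L) :
  (u * N = t * M + 1)%N -> size f = (M * e).+1 -> size g = (N * e).+1 ->
  (0 < M)%N -> (0 < N)%N -> e%:R != 0 :> L -> root (branch_roots e f g) rho ->
  exists (K : fieldType) (psi : {rmorphism {poly {poly L}} -> K}) (v : K -> int),
    [/\ psi (sep_poly f g) = 0, is_point psi v, v (psi (coordX L)) = - N%:Z,
        v (psi (coordY L)) = - M%:Z & branch_at M N psi v rho].
Proof.
move=> uN size_f size_g M_gt0 N_gt0 e_neq0 rt.
pose G := sep_chart M N t u e f g; pose w := hensel G rho.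
have [G_root G_simple] := sep_chart_root uN size_f size_g M_gt0 N_gt0 e_neq0 rt.
have coh := hensel_coherent G rho; rewrite -/w in coh.
have [K [eps eps_p]] := prime_ideal_function_field (branch_ideal_prime coh).
have oD a b : a \notin branch_ideal w -> b \notin branch_ideal w ->
    a + b \notin branch_ideal w ->
    Num.min (branch_order w a)%:Z (branch_order w b)%:Z <=
      (branch_order w (a + b))%:Z.
  move=> ha hb hab; have := branch_orderD coh ha hb hab.
  by rewrite ge_min_int !lez_nat geq_min.
have [Xp oX] := branch_order_coordX coh.
have [||||v [v_point vE]] := exists_point_of_order eps_p
    (o := fun a => (branch_order w a)%:Z) _ oD.
- by move=> a b ha hb; have [_ ->] := branch_orderM coh ha hb; rewrite PoszD.
- by move=> a b ha hb; have [_ ->] := branch_order_mod coh ha hb.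
- by move=> c c0; have [_ ->] := branch_order_const coh c0.
- exists (coordX L), 1; rewrite oX -!polyC1 Xp.
  by have [-> ->] := branch_order_const coh (oner_neq0 L).
set s := eps (coordX L); set W := eps (coordY L).
have s0 : s != 0 by rewrite eps_p.1.
have vs : v s = 1 by rewrite vE // oX.
have rho0 := branch_root_neq0 size_f e_neq0 rt.
(* W - rho may vanish identically on the branch, where [branch_order] has its default value 0. *)
have Wp : coordY L - rho%:P%:P \in branch_ideal w \/
    (0 < branch_order w (coordY L - rho%:P%:P))%N.
  have h : vanish_order_ge w 1 (coordY L - rho%:P%:P).
    rewrite /vanish_order_ge /coordY !hornerE expr1 -['X]subr0 -polyC0 dvdp_XsubCl.
    by rewrite rootE hornerD hornerN hornerC /w hensel0 subrr.
  by have [|/(branch_order_ge coh)/(_ h)] := boolP (_ \in branch_ideal w); [left|right].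
have W_rho : vge v 1 (W - const_morph eps rho).
  rewrite -rmorphB /vge; have := eps_p.1 (coordY L - rho%:P%:P).
  case: Wp => [-> ->//|h] _; have [->//|n0] := eqVneq (eps _) 0.
  by rewrite vE -?eps_p.1 //= lez_nat.
have [W0 vW] : W != 0 /\ v W = 0.
  have kr : const_morph eps rho != 0 by rewrite fmorph_eq0.
  have vk : v (const_morph eps rho) = 0 by apply: point_const v_point _.
  rewrite -(subrK (const_morph eps rho) W) addrC -[X in _ /\ _ = X]vk.
  by apply: (point_dominant v_point) => //; rewrite vk.
have [psi [psiC psiX psiY]] :=
  exists_eval (const_morph eps) (W ^+ t / s ^+ N) (W ^+ u / s ^+ M).
have chart : monomial_chart M N t u psi eps.
  split; [exact: psiC | exact: s0 | | ].
    by rewrite psiX divfK // expf_neq0.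
  by rewrite psiY divfK // expf_neq0.
have psi_point : is_point psi v by apply: is_point_const v_point => c; rewrite psiC.
have curve : psi (sep_poly f g) = 0.
  have := sep_chartE size_f size_g chart => /eqP.
  have /eqP -> : eps (sep_chart M N t u e f g) == 0.
    rewrite eps_p.1; apply/branch_idealP => r.
    by apply: dvdp_trans (hensel_root G_root G_simple r); rewrite dvdp_exp2l.
  by rewrite mulf_eq0 [X in _ || X]expf_eq0 (negPf s0) andbF orbF => /eqP.
have vx : v (psi (coordX L)) = - N%:Z.
  rewrite psiX (pointM v_point) ?invr_eq0 ?expf_neq0 // (pointV v_point).
  by rewrite !(pointX v_point) vW vs mul0rn add0r natz.
have vy : v (psi (coordY L)) = - M%:Z.
  rewrite psiY (pointM v_point) ?invr_eq0 ?expf_neq0 // (pointV v_point).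
  by rewrite !(pointX v_point) vW vs mul0rn add0r natz.
exists K, psi, v; split=> //.
have v_bd : boundary psi v by apply/(boundaryP psi_point); left; rewrite vx; lia.
apply/(branch_atE size_f size_g M_gt0 N_gt0 e_neq0 curve v_bd).
rewrite (_ : const_morph psi rho = const_morph eps rho); last first.
  by rewrite /const_morph psiC.
(* Y^N / X^M = W^(u N - t M) = W. *)
rewrite (_ : _ / _ = W) // psiX psiY !expr_div_n -!exprM.
rewrite uN addn1 exprS (mulnC N) invf_div mulrACA.
by rewrite mulrA mulfK ?expf_neq0 // mulfK ?expf_neq0.
Qed.

(** * Components *)

Section Primes.
Variable L : closedFieldType.
Implicit Types (p q : {pred {poly {poly L}}}) (h P : {poly {poly L}}).

(* A prime without nonzero polynomial in X corresponds to a curve that is not *)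
(* a vertical line, and is generated, after localizing at L[X] \ 0, by any of *)
(* its nonzero elements of least degree in Y.                                 *)
Definition dominant_X p : Prop := forall c : {poly L}, c != 0 -> c%:P \notin p.

Lemma prime0 p : prime_ideal p -> 0 \in p.
Proof. by case=> -[]. Qed.

Lemma primeD p : prime_ideal p -> {in p &, forall a b, a + b \in p}.
Proof.
by case=> -[_ _ h] _ a b ap bp; have := h 1 a b ap bp; rewrite mul1r.
Qed.

Lemma primeMl p a b : prime_ideal p -> b \in p -> a * b \in p.
Proof.
by move=> pp bp; case: (pp) => -[p0 _ h] _; rewrite -[_ * _]addr0; apply: h.
Qed.

Lemma primeB p : prime_ideal p -> {in p &, forall a b, a - b \in p}.
Proof.
by move=> pp a b ap bp; apply: primeD => //; rewrite -mulN1r primeMl.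
Qed.

Lemma primeM p a b : prime_ideal p -> (a * b \in p) = (a \in p) || (b \in p).
Proof.
move=> pp; apply/idP/idP => [|/orP[|/primeMl]]; last exact.
  by case: pp => _; apply.
by rewrite mulrC => /primeMl; apply.
Qed.

Lemma prime1 p : prime_ideal p -> 1 \notin p.
Proof. by case=> -[]. Qed.

(** Pseudo-division by an element P of least degree in Y works because dominance allows factors from
    L[X] to be cancelled in p. If a is not in p, neither is gcd(P, a), so the cofactor of P is in p
    and minimality leaves the gcd of degree 0 in Y. *)
Lemma dominant_generator p h : prime_ideal p -> dominant_X p -> h \in p -> h != 0 ->
  exists P, [/\ P \in p, (1 < size P)%N, forall a, (a \in p) = (P %| a)
    & forall a, a \notin p -> coprimep P a].
Proof.
move=> pp pX hp h0.
pose Q n := `[< exists P, [/\ P \in p, P != 0 & size P = n] >].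
have exQ : exists n, Q n by exists (size h); apply/asboolP; exists h.
have [n /asboolP[P [Pp P0 sP]] minP] := ex_minnP exQ.
have {}minP a : a \in p -> a != 0 -> (size P <= size a)%N.
  by move=> ap a0; rewrite sP; apply: minP; apply/asboolP; exists a.
have lP k : lead_coef P ^+ k != 0 by rewrite expf_neq0 // lead_coef_eq0.
have scale_p (c : {poly L}) a : c != 0 -> (c *: a \in p) = (a \in p).
  by move=> c0; rewrite -mul_polyC primeM // (negPf (pX _ c0)).
have size_P : (1 < size P)%N.
  rewrite ltnNge; apply/negP => /size1_polyC eP.
  by have := pX P`_0; rewrite -polyC_eq0 -eP P0 Pp => /(_ isT).
have dvdE a : (a \in p) = (P %| a).
  apply/idP/idP => [ap|/Pdiv.Idomain.dvdpP[[c r] /= c0 e]]; last first.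
    by rewrite -(scale_p c) // e primeMl.
  have e := Pdiv.Idomain.divp_eq a P.
  have rp : a %% P \in p.
    rewrite -[a %% P](addKr (a %/ P * P)) addrC -e.
    by apply: primeB => //; [rewrite scale_p | apply: primeMl].
  rewrite /dvdp; apply/negPn/negP => r0; have := minP _ rp r0.
  by rewrite leqNgt ltn_modp P0.
exists P; split=> // a ap.
rewrite /coprimep; have /Pdiv.Idomain.dvdpP[[c r] /= c0 e] := dvdp_gcdl P a.
have gp : gcdp P a \notin p.
  apply: contra ap; rewrite !dvdE => h1; exact: dvdp_trans h1 (dvdp_gcdr _ _).
have rp : r \in p.
  have : c *: P \in p by rewrite scale_p.
  by rewrite e primeM // (negPf gp) orbF.
have r0 : r != 0.
  apply: contraNneq P0 => r0; have := e; rewrite r0 mul0r => /eqP.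
  by rewrite scale_poly_eq0 (negPf c0).
have g0 : gcdp P a != 0 by rewrite gcdp_eq0 (negPf P0).
have := congr1 (fun z : {poly {poly L}} => size z) e; rewrite size_scale // size_mul //.
have := minP r rp r0; have : (0 < size (gcdp P a))%N by rewrite size_poly_gt0.
by move: (size P) (size r) (size (gcdp P a)) => x y z h1 h2 h3; apply/eqP; lia.
Qed.

(** Let P, Q generate p, q over L(X). As P divides Q, it cannot be coprime to Q without being
    coprime to itself; hence P lies in q. *)
Lemma dominant_minimal p q h : prime_ideal p -> prime_ideal q -> dominant_X p ->
  h \in q -> h != 0 -> {subset q <= p} -> {subset p <= q}.
Proof.
move=> pp qp pX hq h0 sub.
have qX : dominant_X q by move=> c c0; apply: contra (pX c c0) => /sub.
have [P [Pp sP dvdE _]] := dominant_generator pp pX (sub _ hq) h0.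
have [Q [Qq sQ dvdE' coQ]] := dominant_generator qp qX hq h0.
have Pq : P \in q.
  apply: contraT => /coQ; rewrite coprimep_sym => co.
  have := coprimep_dvdl (_ : P %| Q) co; rewrite -dvdE => /(_ (sub _ Qq)).
  by rewrite coprimepp => /eqP e; rewrite e in sP.
move=> a; rewrite dvdE => /Pdiv.Idomain.dvdpP[[c r] /= c0 e].
have : c *: a \in q by rewrite e primeMl.
by rewrite -mul_polyC primeM // (negPf (qX _ c0)).
Qed.

(** [kappa] reads a one-variable polynomial in X or in Y; it splits into linear factors, and
    primality selects one of them. *)
Lemma root_in_prime p (c : {poly L}) (X : {poly {poly L}})
    (kappa : {rmorphism {poly L} -> {poly {poly L}}}) :
  prime_ideal p -> c != 0 ->
  (forall a : L, a != 0 -> kappa a%:P \notin p) ->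
  kappa c \in p -> exists x0, kappa ('X - x0%:P) \in p.
Proof.
move=> pp c0 kC; have [rs ->] := closed_field_poly_normal c.
rewrite -mul_polyC rmorphM primeM // (negPf (kC _ _)) ?lead_coef_eq0 //=.
elim: rs => [|x0 rs IH].
  by rewrite big_nil rmorph1 (negPf (prime1 pp)).
rewrite big_cons rmorphM primeM // => /orP[h|/IH//]; by exists x0.
Qed.

(** Gauss's lemma, by removing the linear factors X - x0 of c one at a time: modulo such a factor
    the product A B is zero, so it divides A or B. *)
Lemma gauss_split (c : {poly L}) (P A B : {poly {poly L}}) : c != 0 ->
  c *: P = A * B ->
  exists A' B', [/\ P = A' * B', size A' = size A & size B' = size B].
Proof.
have [n] := ubnP (size c); elim: n c A B => // n IH c A B; rewrite ltnS => sc c0 e.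
have [/size1_polyC ec|sc1] := leqP (size c) 1.
  have c00 : c`_0 != 0 by rewrite -polyC_eq0 -ec.
  exists ((c`_0)^-1%:P *: A), B; rewrite size_scale ?polyC_eq0 ?invr_eq0 //.
  split=> //; rewrite -scalerAl -e scalerA {2}ec -polyCM mulVf // polyC1 scale1r.
  by [].
have [x0 /factor_theorem[d ed]] : exists x0, root c x0.
  by apply: closed_rootP; rewrite neq_ltn sc1 orbT.
have d0 : d != 0 by apply: contraNneq c0 => d0; rewrite ed d0 mul0r.
have X0 : 'X - x0%:P != 0 :> {poly L} by rewrite polyXsubC_eq0.
have X0' : ('X - x0%:P)%:P != 0 :> {poly {poly L}} by rewrite polyC_eq0.
have divide (H : {poly {poly L}}) : map_poly (horner_eval x0) H = 0 ->
    exists H', H = ('X - x0%:P) *: H'.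
  move=> H0; exists (map_poly (fun z => z %/ ('X - x0%:P)) H).
  apply/polyP => i; rewrite coefZ coef_map_id0 ?div0p // mulrC divpK //.
  rewrite dvdp_XsubCl; have := congr1 (fun z : {poly L} => z`_i) H0.
  by rewrite coef_map coef0 => /eqP.
have scd : (size d < n)%N.
  move: sc; rewrite ed size_mul // size_XsubC addnC /=.
  by [].
have /eqP : map_poly (horner_eval x0) A * map_poly (horner_eval x0) B = 0.
  rewrite -rmorphM -e; apply/polyP => i.
  rewrite coef_map coefZ coef0 /= /horner_eval ed !hornerM hornerXsubC.
  by rewrite subrr mulr0 mul0r.
rewrite mulf_eq0 => /orP[/eqP/divide[H eH]|/eqP/divide[H eH]].
- have [|A' [B' [e1 e2 e3]]] := IH d H B scd d0.
    by apply: (mulfI X0'); rewrite !mul_polyC scalerA mulrC -ed e eH scalerAl.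
  by exists A', B'; rewrite e1 e2 e3 eH size_scale.
- have [|A' [B' [e1 e2 e3]]] := IH d A H scd d0.
    by apply: (mulfI X0'); rewrite !mul_polyC scalerA mulrC -ed e eH scalerAr.
  by exists A', B'; rewrite e1 e2 e3 eH size_scale.
Qed.

End Primes.

Definition minimal_prime (L : closedFieldType) (F : {poly {poly L}})
    (p : {pred {poly {poly L}}}) : Prop :=
  [/\ prime_ideal p, F \in p
    & forall q : {pred {poly {poly L}}}, prime_ideal q -> F \in q ->
        {subset q <= p} -> {subset p <= q}].

Lemma map_sep_poly (k L : fieldType) (iota : {rmorphism k -> L}) (f g : {poly k}) :
  map_poly (map_poly iota) (sep_poly f g) =
  sep_poly (map_poly iota f) (map_poly iota g).
Proof.
rewrite rmorphB /= map_polyC /=; congr (_ - _).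
by apply/polyP => i; rewrite !coef_map /= map_polyC.
Qed.

(** A prime contains the radical of an ideal as soon as it contains the ideal, so only F itself
    matters. *)
Lemma componentsE (k : fieldType) (L : closedFieldType) (iota : {rmorphism k -> L})
    (f g : {poly k}) (p : {pred {poly {poly L}}}) :
  components iota f g p <->
  minimal_prime (sep_poly (map_poly iota f) (map_poly iota g)) p.
Proof.
have containsE q : prime_ideal q -> contains_curve_ideal iota f g q <->
    sep_poly (map_poly iota f) (map_poly iota g) \in q.
  move=> pq; rewrite -map_sep_poly; split=> [h|h G [r [a e]]].
    by apply: h; exists 1%N, 1; rewrite expr1 mul1r.
  have : map_poly (map_poly iota) G ^+ r \in q.
    by rewrite -rmorphXn /= e rmorphM primeMl.
  elim: r {e} => [|r IH]; first by rewrite expr0 (negPf (prime1 pq)).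
  by rewrite exprS primeM // => /orP[|/IH].
split=> -[pp /(containsE _ pp) h minp]; split=> // q qp.
  by move=> /(containsE _ qp); apply: minp.
by move=> /(containsE _ qp); apply: minp.
Qed.

Section Dominance.
Variables (L : closedFieldType) (f g : {poly L}).
Hypotheses (f_nc : (1 < size f)%N) (g_nc : (1 < size g)%N).
Local Notation F := (sep_poly f g).

Lemma lead_coef_sep_poly : lead_coef F = - (lead_coef g)%:P.
Proof.
rewrite /sep_poly addrC lead_coefDl ?lead_coefN ?lead_coef_map_eq //.
- by rewrite polyC_eq0 lead_coef_eq0 -size_poly_gt0 ltnW.
- by rewrite size_polyN size_map_polyC (leq_ltn_trans (size_polyC_leq1 _)).
Qed.

Lemma size_sep_poly : size F = size g.
Proof.
rewrite /sep_poly addrC size_polyDl size_polyN size_map_polyC //.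
by rewrite (leq_ltn_trans (size_polyC_leq1 _)).
Qed.

Lemma sep_poly_neq0 : F != 0.
Proof. by rewrite -size_poly_gt0 size_sep_poly ltnW. Qed.

(* Otherwise p is the ideal of a point (x0, y0), and a divisor of F of least  *)
(* degree in Y vanishing at that point generates, by Gauss's lemma, a smaller *)
(* prime ideal which contains F but no nonzero polynomial in X.               *)
Lemma minimal_prime_dominant p : minimal_prime F p -> dominant_X p.
Proof.
case=> pp Fp minp c c0; apply/negP => cp.
have const_p (a : L) : a != 0 -> a%:P%:P \notin p.
  move=> a0; apply: contra (prime1 pp) => ap.
  have := primeMl (a^-1)%:P%:P pp ap.
  by rewrite -!polyCM mulVf.
have [x0 x0p] := @root_in_prime _ p c 0 polyC pp c0 const_p cp.
have gp : map_poly polyC (g - f.[x0]%:P) \in p.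
  have -> : map_poly polyC (g - f.[x0]%:P) = (f - f.[x0]%:P)%:P - F.
    by rewrite /sep_poly rmorphB /= map_polyC polyCB addrAC subKr addrC.
  apply: primeB => //; have /factor_theorem[q ->] : root (f - f.[x0]%:P) x0.
    by rewrite rootE !hornerE subrr.
  by rewrite polyCM primeMl.
have [y0 y0p] : exists y0 : L, 'X - y0%:P%:P \in p.
  have g0 : g - f.[x0]%:P != 0.
    rewrite -size_poly_gt0 size_polyDl ?(ltnW g_nc) // size_polyN.
    by rewrite (leq_ltn_trans (size_polyC_leq1 _)).
  have [|y0] := @root_in_prime _ p _ 0 (map_poly polyC) pp g0 _ gp.
    by move=> a /const_p; rewrite /= map_polyC.
  by rewrite rmorphB /= map_polyX map_polyC; exists y0.
(* p is the maximal ideal of (x0, y0), so membership is vanishing there. *)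
have evalp h : (h.[y0%:P].[x0] == 0) = (h \in p).
  have [q eq] := horner_expansion h y0%:P.
  have [q' eq'] := horner_expansion h.[y0%:P] x0.
  pose r := h.[y0%:P].[x0]; have hr : h - r%:P%:P \in p.
    rewrite {1}eq {1}eq' polyCD -/r [_ - _]addrC addrA addKr polyCM.
    by rewrite primeD ?primeMl.
  have [r0|r0] := eqVneq r 0; first by rewrite -[h]subr0 -polyC0 -polyC0 -r0 hr.
  apply/esym/negP => hp; have /negP := const_p r r0; apply.
  by rewrite -[_%:P%:P](subKr h) primeB.
pose ev h : L := h.[y0%:P].[x0].
pose Q n := `[< exists P, [/\ ev P = 0, exists R, F = P * R & size P = n] >].
have exQ : exists n, Q n.
  exists (size F); apply/asboolP; exists F; split=> //; last by exists 1; rewrite mulr1.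
  by apply/eqP; rewrite evalp.
have [n /asboolP[P [P0 [R eF] sP]] minP] := ex_minnP exQ.
have {}minP A : ev A = 0 -> (exists R, F = A * R) -> (size P <= size A)%N.
  by move=> h1 h2; rewrite sP; apply: minP; apply/asboolP; exists A.
have Pn0 : P != 0 by apply: contraNneq sep_poly_neq0 => h; rewrite eF h mul0r.
(* The leading coefficient of F in Y is a nonzero constant, so that of its divisor P is a unit, and
   pseudo-divisibility by P is divisibility. *)
have lP : lead_coef P \is a GRing.unit.
  have : lead_coef P * lead_coef R \is a GRing.unit.
    rewrite -lead_coefM -eF lead_coef_sep_poly unitrN.
    by rewrite poly_unitE size_polyC coefC /= unitfE lead_coef_eq0 -size_poly_gt0 ltnW.
  by rewrite unitrM => /andP[].
have size_P : (1 < size P)%N.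
  rewrite ltnNge; apply/negP => /size1_polyC eP; move: lP P0.
  rewrite eP lead_coefC /ev hornerC poly_unitE => /andP[/size_poly1P[a a0 ->] _].
  by rewrite hornerC => /eqP; rewrite (negPf a0).
pose q : {pred {poly {poly L}}} := [pred h | P %| h].
have qE h : (h \in q) = (P %| h) by [].
have dvdE h : P %| h -> exists r, h = r * P by move=> /(Pdiv.IdomainUnit.dvdpP lP).
have q_prime : prime_ideal q.
  split; [split|] => [||a h h'|h h']; rewrite ?qE.
  - exact: dvdp0.
  - by rewrite dvdp1 neq_ltn size_P orbT.
  - by move=> h1 h2; rewrite dvdp_add // dvdp_mull.
  have [//|ndvd] := boolP (P %| h); rewrite /= => Phh'.
  (* Gauss's lemma turns gcd(P, h) into a genuine factor B of P = A B. One of A, B vanishes at the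
     point, so by minimality it has the full degree of P: either the gcd is trivial and P divides
     h', or P divides h. *)
  have /Pdiv.Idomain.dvdpP[[c' r] /= c'0 e] := dvdp_gcdl P h.
  have [A [B [eAB sA sB]]] := gauss_split c'0 e.
  have fac A' B' : P = A' * B' -> exists R, F = A' * R.
    by move=> e'; exists (B' * R); rewrite eF e' mulrA.
  have szP : (size P).+1 = (size A + size B)%N.
    have A0 : A != 0 by apply: contraNneq Pn0 => h0; rewrite eAB h0 mul0r.
    have B0 : B != 0 by apply: contraNneq Pn0 => h0; rewrite eAB h0 mulr0.
    by rewrite eAB size_mul // prednK // addn_gt0 size_poly_gt0 A0.
  have G0 : (0 < size (gcdp P h))%N by rewrite size_poly_gt0 gcdp_eq0 (negPf Pn0).
  move: P0; rewrite {1}eAB /ev !hornerM => /eqP; rewrite mulf_eq0 => /orP[]/eqP h0.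
    have le_PA : (size P <= size A)%N by apply: minP (fac A B eAB).
    suff co : coprimep P h by rewrite -(Gauss_dvdpr _ co).
    rewrite /coprimep eqn_leq G0 andbT -sB -(leq_add2l (size A)) -szP addn1.
    by rewrite ltnS.
  have le_PB : (size P <= size B)%N.
    by apply: minP (fac B A _) => //; rewrite eAB mulrC.
  case/negP: ndvd; apply: dvdp_trans (dvdp_gcdr P h).
  have : gcdp P h %= P.
    by rewrite -dvdp_size_eqp ?dvdp_gcdl // eqn_leq leq_gcdpl // -sB.
  by case/andP.
have qp : {subset q <= p}.
  by move=> h; rewrite qE => /dvdE[r ->]; rewrite primeMl // -evalp; apply/eqP.
have Fq : F \in q by rewrite qE eF dvdp_mulr.
(* Minimality of p puts c in q, yet c has degree 0 in Y, less than P. *)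
have := minp q q_prime Fq qp _ cp; rewrite qE gtNdvdp ?polyC_eq0 //.
by rewrite (leq_ltn_trans (size_polyC_leq1 _)).
Qed.

End Dominance.

(** * Degree of the function X *)

Section MapDegree.
Variables (L : closedFieldType) (K : fieldType).
Variable phi : {rmorphism {poly {poly L}} -> K}.
Variable p : {pred {poly {poly L}}}.
Hypothesis phi_p : is_function_field phi p.
Variable P : {poly {poly L}}.
Hypothesis size_P : (1 < size P)%N.
Hypothesis dvdP : forall a, (a \in p) = (P %| a).
Hypothesis coP : forall a, a \notin p -> coprimep P a.

Local Notation x := (phi (coordX L)).
Local Notation y := (phi (coordY L)).

Let phi_C_eq0 (c : {poly L}) : (phi c%:P == 0) = (c == 0).
Proof.
rewrite phi_p.1 dvdP; have [->|c0] := eqVneq c 0; first by rewrite polyC0 dvdp0.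
by rewrite gtNdvdp ?polyC_eq0 // size_polyC c0.
Qed.

Lemma rational_subfieldE z : rational_subfield phi x z <->
  exists a b : {poly L}, b != 0 /\ z = phi a%:P / phi b%:P.
Proof.
have evE q : (map_poly (fun c => phi c%:P%:P) q).[x] = phi q%:P.
  exact/esym/phi_polyC.
split=> -[a [b [b0 ->]]]; exists a, b; move: b0; rewrite /= !evE phi_C_eq0.
  by [].
by [].
Qed.

Lemma rational_subfieldB z z' : rational_subfield phi x z ->
  rational_subfield phi x z' -> rational_subfield phi x (z - z').
Proof.
move=> /rational_subfieldE[a [b [b0 ->]]] /rational_subfieldE[a' [b' [b0' ->]]].
apply/rational_subfieldE; exists (a * b' - a' * b), (b * b').
rewrite mulf_neq0 //; split=> //.
by rewrite -mulNr addf_div ?phi_C_eq0 // mulNr polyCB !polyCM rmorphB !rmorphM.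
Qed.

(** After clearing denominators, a relation is an element of p of smaller degree in Y than P, hence
    zero. *)
Lemma powers_free (d : 'I_(size P).-1 -> K) :
  (forall j, rational_subfield phi x (d j)) -> \sum_j d j * y ^+ j = 0 ->
  forall j, d j = 0.
Proof.
move=> ratd sum0.
have /choice[ab abP] j : exists ab : {poly L} * {poly L},
    ab.2 != 0 /\ d j = phi ab.1%:P / phi ab.2%:P.
  by have /rational_subfieldE[a [b H]] := ratd j; exists (a, b).
pose B := \prod_j (ab j).2; pose a j := (ab j).1 * \prod_(i | i != j) (ab i).2.
have B0 : B != 0 by apply/prodf_neq0 => j _; case: (abP j).
have dE j : d j = phi (a j)%:P / phi B%:P.
  have [b0 ->] := abP j.
  have BE : B = (ab j).2 * \prod_(i | i != j) (ab i).2 by rewrite /B (bigD1 j).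
  rewrite /a BE !polyCM !rmorphM -mulf_div divff ?mulr1 //.
  by rewrite phi_C_eq0; apply/prodf_neq0 => i _; case: (abP i).
pose h : {poly {poly L}} := \sum_j (a j)%:P * 'X^j.
have hE : h = \poly_(j < (size P).-1) (if insub j is Some j' then a j' else 0).
  by rewrite poly_def; apply: eq_bigr => j _; rewrite valK mul_polyC.
have h0 : h = 0.
  apply/eqP; apply: contraT => hn0; have : phi h == 0.
    rewrite rmorph_sum; apply/eqP; apply: (mulfI (_ : (phi B%:P)^-1 != 0)).
      by rewrite invr_eq0 phi_C_eq0.
    rewrite mulr0 -[RHS]sum0 big_distrr /=; apply: eq_bigr => j _.
    by rewrite dE rmorphM rmorphXn mulrA [_^-1 * _]mulrC.
  rewrite phi_p.1 dvdP => /(dvdp_leq hn0); rewrite leqNgt hE.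
  by rewrite (leq_ltn_trans (size_poly _ _)) // prednK // ltnW.
move=> j; rewrite dE; have := congr1 (fun q : {poly {poly L}} => q`_j) hE.
by rewrite /= h0 coef0 coef_poly ltn_ord valK => <-; rewrite polyC0 rmorph0 mul0r.
Qed.

(** The powers of Y below deg_Y P form a basis: a Bezout relation u1 P + u2 b = c(X) replaces the
    denominator b by a polynomial in X, and pseudo-division by P reduces the numerator. *)
Lemma map_degree_coordX : has_map_degree phi x (size P).-1.
Proof.
exists (fun j => y ^+ j) => z.
have [a [b [b0 ->]]] := phi_p.2 z.
have bp : b \notin p by rewrite -phi_p.1.
have /Bezout_coprimepP[[u1 u2] /= uP] := coP bp.
have [c c0 ec] : exists2 c, c != 0 & u1 * P + u2 * b = c%:P.
  by apply/size_poly1P; rewrite (eqp_size uP) size_poly1.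
have P0 : phi P = 0 by apply/eqP; rewrite phi_p.1 dvdP.
have Pn0 : P != 0 by rewrite -size_poly_gt0 ltnW.
have e1 : phi u2 * phi b = phi c%:P.
  by rewrite -ec rmorphD !rmorphM P0 mulr0 add0r.
pose l := lead_coef P ^+ scalp (a * u2) P.
have l0 : l != 0 by rewrite expf_neq0 // lead_coef_eq0.
pose r := (a * u2) %% P.
have e2 : phi l%:P * (phi a * phi u2) = phi r.
  rewrite -!rmorphM mul_polyC Pdiv.Idomain.divp_eq rmorphD rmorphM P0 mulr0 add0r.
  by [].
have u20 : phi u2 != 0.
  apply: contraTneq c0 => h; rewrite -phi_C_eq0 -e1 h mul0r eqxx //.
have zE : phi a / phi b = phi r / phi (l * c)%:P.
  rewrite polyCM rmorphM -e1 -e2 -mulf_div divff ?phi_C_eq0 // mul1r.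
  by rewrite [phi u2 * _]mulrC -mulf_div divff // mulr1.
have rE : phi r = \sum_(j < (size P).-1) phi (r`_j)%:P * y ^+ j.
  have sr : (size r <= (size P).-1)%N.
    by rewrite -ltnS prednK ?ltn_modpN0 // ltnW.
  rewrite phi_expand (big_ord_widen _ (fun j => phi (r`_j)%:P * y ^+ j) sr).
  rewrite big_mkcond; apply: eq_bigr => j _; case: ltnP => // h.
  by rewrite nth_default // polyC0 rmorph0 mul0r.
exists [ffun j : 'I_(size P).-1 => phi (r`_j)%:P / phi (l * c)%:P]; split.
  split=> [j|].
    rewrite ffunE; apply/rational_subfieldE; exists r`_j, (l * c).
    by rewrite mulf_neq0.
  rewrite zE rE mulr_suml; apply: eq_bigr => j _.
  by rewrite ffunE mulrAC.
move=> c' [ratc' ec']; apply/ffunP => j; apply/eqP; rewrite -subr_eq0; apply/eqP.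
move: j; apply: powers_free => [j|].
  apply: rational_subfieldB => //; rewrite ffunE; apply/rational_subfieldE.
  by exists r`_j, (l * c); rewrite mulf_neq0.
under eq_bigr do rewrite mulrBl.
rewrite sumrB -ec' zE rE mulr_suml; apply/eqP; rewrite subr_eq0; apply/eqP.
by apply: eq_bigr => j _; rewrite ffunE mulrAC.
Qed.

End MapDegree.

(** * Counting *)

(** Stated for a relation, because [branch_at] links points to roots and is known only by existence
    and uniqueness on both sides. *)
Lemma card_eq_size (T : Type) (U : eqType) (A : set T) (r : T -> U -> Prop)
    (s : seq U) : uniq s ->
  (forall v, A v -> exists2 z, z \in s & r v z) ->
  (forall v z z', A v -> r v z -> r v z' -> z = z') ->
  (forall z, z \in s -> exists2 v, A v & r v z) ->
  (forall v v' z, A v -> A v' -> r v z -> r v' z -> v = v') ->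
  (A #= `I_(size s))%card.
Proof.
move=> s_uniq ex_z z_unique ex_v v_unique; apply/card_set_bijP.
pose f v := xget 0%N [set k | exists2 z, r v z & index z s = k].
have fE v z : A v -> r v z -> f v = index z s.
  move=> Av rvz; apply: xget_unique; first by exists z.
  by move=> k [z' rvz' <-]; rewrite (z_unique v z z').
exists f; split.
- by move=> v Av; have [z zs rvz] := ex_z v Av; rewrite /= (fE v z) // index_mem.
- move=> v v' /set_mem Av /set_mem Av'.
  have [z zs rvz] := ex_z v Av; have [z' zs' rvz'] := ex_z v' Av'.
  rewrite (fE v z) // (fE v' z') // => e; apply: (v_unique v v' z) => //.
  by rewrite -(nth_index z zs) e nth_index.
- move=> k /= lt_k; have /mem_nth h := lt_k.
  case: s s_uniq ex_z ex_v f fE lt_k h => // z0 s s_uniq ex_z ex_v f fE lt_k /(_ z0) h.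
  have [v Av rv] := ex_v _ h; exists v => //.
  by rewrite (fE v _ Av rv) index_uniq.
Qed.

Lemma coprime_prod_dvd (R : idomainType) (I : eqType) (F : {poly R})
    (P : I -> {poly R}) (r : seq I) :
  (forall i j, i != j -> coprimep (P i) (P j)) -> (forall i, P i %| F) ->
  (forall i, P i != 0) -> uniq r ->
  \prod_(i <- r) P i %| F /\
  (size (\prod_(i <- r) P i)) = (\sum_(i <- r) (size (P i)).-1).+1.
Proof.
move=> coP dvdF Pn0; elim: r => [|i r IH] /=.
  by rewrite !big_nil dvd1p size_poly1.
move=> /andP[ir /IH[dvd_r size_r]]; rewrite !big_cons.
have rn0 : \prod_(j <- r) P j != 0 by rewrite -size_poly_gt0 size_r.
split; last first.
  by rewrite size_mul // size_r addnS /= -[in LHS](@prednK (size (P i))) ?size_poly_gt0.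
rewrite Gauss_dvdp ?dvdF // {IH dvd_r size_r rn0}.
elim: r ir => [|j r IH]; first by rewrite big_nil coprimep1.
rewrite inE negb_or => /andP[ij /IH h]; rewrite big_cons coprimepMr h andbT.
exact: coP.
Qed.

(** [E] may be larger than the function field of p; the last hypothesis ensures that v stays
    normalized when restricted. *)
Lemma point_transport (L : closedFieldType) (K E : fieldType)
    (phi : {rmorphism {poly {poly L}} -> K}) (psi : {rmorphism {poly {poly L}} -> E})
    (p : {pred {poly {poly L}}}) (v : E -> int) :
  is_function_field phi p -> (forall h, (psi h == 0) = (h \in p)) ->
  is_point psi v ->
  (exists a b, [/\ a \notin p, b \notin p & v (psi a) = v (psi b) + 1]) ->
  exists v', is_point phi v' /\ forall h, h \notin p -> v' (phi h) = v (psi h).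
Proof.
move=> phi_p psi_p v_point surj.
have psi_n0 h : h \notin p -> psi h != 0 by rewrite -psi_p.
apply: (exists_point_of_order phi_p (o := fun h => v (psi h))) => //.
- by move=> a b /psi_n0 ha /psi_n0 hb; rewrite rmorphM (pointM v_point).
- move=> a b /psi_n0 ha /psi_n0 hb /psi_n0; rewrite rmorphD => hab.
  by case: v_point => _ _ h _ _; apply: h.
- by move=> a b _; rewrite -psi_p rmorphD => /eqP ->; rewrite addr0.
- by move=> c c0; case: v_point => _ _ _ h _; apply: h.
Qed.

(** * Distribution of the roots among the components *)

Section Components.
Variables (L : closedFieldType) (M N t u e : nat) (f g : {poly L}).
Hypothesis uN : (u * N = t * M + 1)%N.
Hypothesis size_f : size f = (M * e).+1.
Hypothesis size_g : size g = (N * e).+1.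
Hypothesis M_gt0 : (0 < M)%N.
Hypothesis N_gt0 : (0 < N)%N.
Hypothesis e_neq0 : e%:R != 0 :> L.
Local Notation F := (sep_poly f g).
Local Notation roots := (branch_roots e f g).

Variables (s : nat) (C : 'I_s -> {pred {poly {poly L}}}).
Hypothesis C_bij : set_bij [set: 'I_s] [set p | minimal_prime F p] C.
Variable K : 'I_s -> fieldType.
Variable phi : forall i, {rmorphism {poly {poly L}} -> K i}.
Hypothesis phi_C : forall i, is_function_field (phi i) (C i).

Let e_gt0 : (0 < e)%N.
Proof. by case: e e_neq0 => //; rewrite eqxx. Qed.

Let f_nc : (1 < size f)%N. Proof. by rewrite size_f ltnS muln_gt0 M_gt0. Qed.
Let g_nc : (1 < size g)%N. Proof. by rewrite size_g ltnS muln_gt0 N_gt0. Qed.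

Let C_min i : minimal_prime F (C i).
Proof. by case: C_bij => h _ _; apply: h. Qed.

Let C_prime i : prime_ideal (C i). Proof. by case: (C_min i). Qed.

Let C_dominant i : dominant_X (C i).
Proof. exact: minimal_prime_dominant (C_min i). Qed.

Let curve i : phi i F = 0.
Proof. by apply/eqP; rewrite (phi_C i).1; case: (C_min i). Qed.

Let branch i rho := exists2 v, boundary (phi i) v & branch_at M N (phi i) v rho.

(** The kernel of psi is a prime containing F. It is dominant because X has a pole, so it is minimal
    by [dominant_minimal], hence one of the C_i. *)
Let exists_component rho : root roots rho -> exists i, branch i rho.
Proof.
move=> rt; have [E [psi [v [psiF v_point vx vy v_rho]]]] :=
  exists_branch_field uN size_f size_g M_gt0 N_gt0 e_neq0 rt.
have v_bd : boundary psi v by apply/(boundaryP v_point); left; rewrite vx; lia.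
pose p : {pred {poly {poly L}}} := [pred h | psi h == 0].
have pE h : (psi h == 0) = (h \in p) by [].
have p_prime : prime_ideal p.
  split; [split|] => [||a h h'|h h']; rewrite -?pE.
  - by rewrite rmorph0.
  - by rewrite rmorph1 oner_eq0.
  - by rewrite rmorphD rmorphM => /eqP -> /eqP ->; rewrite mulr0 addr0.
  - by rewrite rmorphM mulf_eq0.
have Fp : F \in p by rewrite -pE psiF.
have p_dom : dominant_X p.
  move=> c c0; rewrite -pE phi_polyC.
  by have [] := point_horner v_point (_ : v (psi (coordX L)) < 0) c0; rewrite ?vx //; lia.
have p_min : minimal_prime F p.
  split=> // q q_prime Fq; apply: (dominant_minimal p_prime q_prime p_dom Fq).
  exact: sep_poly_neq0.
have [i _ Ci] : exists2 i, [set: 'I_s] i & C i = p.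
  by case: C_bij => _ _ h; have [i ? ?] := h p p_min; exists i.
have psi_C h : (psi h == 0) = (h \in C i) by rewrite Ci.
have Xp : coordX L \notin C i.
  by rewrite -psi_C; apply: contraTneq isT => h; move: vx; rewrite h (point0 v_point); lia.
have Yp : coordY L \notin C i.
  by rewrite -psi_C; apply: contraTneq isT => h; move: vy; rewrite h (point0 v_point); lia.
have Xn k : coordX L ^+ k \notin C i.
  by rewrite -(phi_C i).1 rmorphXn expf_neq0 // (phi_C i).1.
have Yn k : coordY L ^+ k \notin C i.
  by rewrite -(phi_C i).1 rmorphXn expf_neq0 // (phi_C i).1.
have [|v' [v'_point v'E]] := point_transport (phi_C i) psi_C v_point.
  (* The quotient Y^t / X^u is the uniformizer s: its valuation is u N - t M = 1. *)
  exists (coordY L ^+ t), (coordX L ^+ u); split; [exact: Yn | exact: Xn |].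
  rewrite !rmorphXn !(pointX v_point) vx vy !mulNrn -!natz -!mulrnA.
  by rewrite (mulnC N) uN mulrnDr mulr1n opprD subrK mulnC.
exists i, v'; first by apply/(boundaryP v'_point); left; rewrite v'E // vx; lia.
move: v_rho; rewrite /branch_at (v'E _ Xp) /vge psi_C -(phi_C i).1.
case: eqVneq => //= n0; rewrite v'E //.
by rewrite -(phi_C i).1.
Qed.

Let branch_component i i' rho : root roots rho -> branch i rho -> branch i' rho ->
  i = i'.
Proof.
move=> rt [v v_bd v_rho] [v' v'_bd v'_rho].
have fm := boundary_formula uN size_f size_g M_gt0 N_gt0 e_neq0 (phi_C i) (curve i)
  v_bd rt v_rho.
have fm' := boundary_formula uN size_f size_g M_gt0 N_gt0 e_neq0 (phi_C i') (curve i')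
  v'_bd rt v'_rho.
case: C_bij => _ C_inj _; apply: C_inj; rewrite ?inE //.
apply/funext => h; rewrite -[LHS]/(h \in C i) -[RHS]/(h \in C i').
by rewrite -!(phi_C _).1 (fm h).1 (fm' h).1.
Qed.

Let branch_point i v v' rho : root roots rho ->
  boundary (phi i) v -> boundary (phi i) v' ->
  branch_at M N (phi i) v rho -> branch_at M N (phi i) v' rho -> v = v'.
Proof.
move=> rt v_bd v'_bd v_rho v'_rho.
have fm := boundary_formula uN size_f size_g M_gt0 N_gt0 e_neq0 (phi_C i) (curve i)
  v_bd rt v_rho.
have fm' := boundary_formula uN size_f size_g M_gt0 N_gt0 e_neq0 (phi_C i) (curve i)
  v'_bd rt v'_rho.
have [v_point _] := v_bd; have [v'_point _] := v'_bd.
apply/funext => z; have [->|z0] := eqVneq z 0.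
  by rewrite (point0 v_point) (point0 v'_point).
have [a [b [b0 ez]]] := (phi_C i).2 z.
have a0 : phi i a != 0 by apply: contraNneq z0 => a0; rewrite ez a0 mul0r.
rewrite ez (pointM v_point) ?invr_eq0 // (pointM v'_point) ?invr_eq0 //.
rewrite (pointV v_point) (pointV v'_point).
by rewrite (fm a).2 // (fm' a).2 // (fm b).2 // (fm' b).2.
Qed.

Lemma components_at_infinity : exists d : 'I_s -> nat,
  [/\ forall i, (boundary (phi i) #= `I_(d i))%card,
      (\sum_(i < s) d i)%N = e,
      forall i (v : K i -> int), boundary (phi i) v ->
        - v (phi i (coordX L)) = N%:Z /\ - v (phi i (coordY L)) = M%:Z
    & forall i, has_map_degree (phi i) (phi i (coordX L)) (N * d i)].
Proof.
have [rs [size_rs uniq_rs] rtE] := branch_roots_split size_f size_g e_neq0.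
pose R i := [seq rho <- rs | `[< branch i rho >]].
have RP i rho : rho \in R i -> root roots rho /\ branch i rho.
  by rewrite mem_filter => /andP[/asboolP ? ?]; rewrite rtE.
have uniq_R i : uniq (R i) by rewrite filter_uniq.
have sum_R : (\sum_(i < s) size (R i))%N = e.
  under eq_bigr do rewrite size_filter -sum1_count big_mkcond.
  rewrite exchange_big /= -[RHS]size_rs -sum1_size big_seq [RHS]big_seq.
  apply: eq_bigr => rho; rewrite -rtE => rt.
  have [i hi] := exists_component rt.
  rewrite (bigD1 i) //= asboolT // big1 ?addn0 // => i' ne_i.
  case: asboolP => // hi'; case/eqP: ne_i.
  exact: branch_component hi' hi.
have bdR i v : boundary (phi i) v -> exists2 rho, rho \in R i & branch_at M N (phi i) v rho.
  move=> v_bd; have [_ _ [rho rt h]] :=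
    boundary_branch uN size_f size_g M_gt0 N_gt0 e_neq0 (phi_C i) (curve i) v_bd.
  by exists rho => //; rewrite mem_filter -rtE rt andbT; apply/asboolP; exists v.
have card_R i : (boundary (phi i) #= `I_(size (R i)))%card.
  have root_unique v z z' : boundary (phi i) v -> branch_at M N (phi i) v z ->
      branch_at M N (phi i) v z' -> z = z'.
    move=> v_bd h h'.
    exact (boundary_branch_unique size_f size_g M_gt0 N_gt0 e_neq0 (curve i)
      v_bd h h').
  apply: (card_eq_size (uniq_R i) (bdR i) root_unique) => [z /RP[_] //|].
  move=> v v' z v_bd v'_bd hz hz'; have [rho /RP[rt _] hrho] := bdR _ _ v_bd.
  have e_rho : rho = z := root_unique _ _ _ v_bd hrho hz; subst z.
  exact: branch_point rt v_bd v'_bd hz hz'.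
have genP i : exists P, [/\ P \in C i, (1 < size P)%N,
    forall a, (a \in C i) = (P %| a) & forall a, a \notin C i -> coprimep P a].
  have [pp Fp _] := C_min i.
  exact (dominant_generator pp (C_dominant i) Fp (sep_poly_neq0 f g_nc)).
have {genP}[P genP] := choice genP.
have Pn0 i : P i != 0 by have [_ h _ _] := genP i; rewrite -size_poly_gt0 ltnW.
have le_R i : (N * size (R i) <= (size (P i)).-1)%N.
  have [Pi sP _ _] := genP i; rewrite -ltnS prednK ?(ltnW sP) //.
  apply: (leading_form_size (M := M) (t := t) (u := u)) => //.
    by apply/negP => /RP[/(branch_root_neq0 size_f e_neq0)]; rewrite eqxx.
  move=> D rho /RP[rt [v v_bd v_rho]] hD.
  have P0 : phi i (P i) = 0 by apply/eqP; rewrite (phi_C i).1.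
  exact (boundary_leading_form uN size_f size_g M_gt0 N_gt0 e_neq0 (curve i) v_bd
    v_rho P0 hD).
(* Distinct minimal primes are incomparable, so the P_i are pairwise coprime divisors of F, and
   their degrees in Y add up to at most deg_Y F = N e. *)
have sum_P : (\sum_(i < s) (size (P i)).-1 <= N * e)%N.
  have [|||dvdF sizeF] := @coprime_prod_dvd _ _ F P (index_enum 'I_s) _ _ Pn0.
  - move=> i j ij; have [_ _ dvdi coi] := genP i; have [Pj _ dvdj _] := genP j.
    apply: coi; apply: contra ij => Pji; apply/eqP.
    have sub : {subset C j <= C i}.
      by move=> a; rewrite dvdi dvdj; apply: dvdp_trans; rewrite -dvdi.
    have [_ _ mini] := C_min i; have [_ Fj _] := C_min j.
    have sub' := mini _ (C_prime j) Fj sub.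
    case: C_bij => _ C_inj _; apply: C_inj; rewrite ?inE //.
    apply/funext => h; rewrite -[LHS]/(h \in C i) -[RHS]/(h \in C j).
    by apply/idP/idP => [/sub'|/sub].
  - by move=> i; have [_ _ <- _] := genP i; case: (C_min i).
  - exact: index_enum_uniq.
  have := dvdp_leq (sep_poly_neq0 f g_nc) dvdF.
  by rewrite sizeF size_sep_poly // size_g ltnS.
(* The termwise bounds [le_R] already sum to N e, so none of them is strict. *)
have eq_R i : (N * size (R i))%N = (size (P i)).-1.
  have le_eq j : true -> (N * size (R j) <= (size (P j)).-1 ?= iff
      (N * size (R j) == (size (P j)).-1))%N by split.
  have [le_sum eq_sum] := leqif_sum le_eq.
  suff : [forall (j | true), N * size (R j) == (size (P j)).-1]%N.
    by move=> /forallP/(_ i)/eqP.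
  by rewrite -eq_sum eqn_leq le_sum -big_distrr /= sum_R sum_P.
exists (fun i => size (R i)); split=> //.
- by move=> i v v_bd; have [h1 h2 _] :=
    boundary_branch uN size_f size_g M_gt0 N_gt0 e_neq0 (phi_C i) (curve i) v_bd.
- move=> i; rewrite eq_R; have [_ sP dvdi coi] := genP i.
  exact (map_degree_coordX (phi_C i) sP dvdi coi).
Qed.

End Components.

(** * Exchange of the variables *)

Section Swap.
Variable L : closedFieldType.
Implicit Types (p q : {pred {poly {poly L}}}) (F : {poly {poly L}}).

Definition swap_pred p : {pred {poly {poly L}}} := [pred h | swapXY h \in p].

Lemma mem_swap_pred p h : (h \in swap_pred p) = (swapXY h \in p).
Proof. by []. Qed.

Lemma swap_predK : involutive swap_pred.
Proof.
by move=> p; apply/funext => h; rewrite -[LHS]/(_ \in p) -[RHS]/(_ \in p) swapXYK.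
Qed.

Lemma swap_prime p : prime_ideal p -> prime_ideal (swap_pred p).
Proof.
move=> pp; split; [split|] => [||a h h'|h h']; rewrite !mem_swap_pred.
- by rewrite rmorph0 prime0.
- by rewrite rmorph1 prime1.
- by move=> ? ?; rewrite rmorphD rmorphM primeD ?primeMl.
- by rewrite rmorphM primeM.
Qed.

(** The sign is there because exchanging X and Y turns g(X) - f(Y) into - (f(X) - g(Y)). *)
Lemma swap_minimal_prime F F' p : swapXY F' = - F ->
  minimal_prime F p -> minimal_prime F' (swap_pred p).
Proof.
move=> eF [pp Fp minp]; split; first exact: swap_prime.
  by rewrite mem_swap_pred eF -mulN1r primeMl.
move=> q qp F'q sub h; rewrite mem_swap_pred => hp.
rewrite -[h]swapXYK -mem_swap_pred.
apply: (minp (swap_pred q) (swap_prime qp) _ _ _ hp).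
  have -> : F = - swapXY F' by rewrite eF opprK.
  by rewrite mem_swap_pred rmorphN /= swapXYK -mulN1r primeMl.
by move=> a /sub; rewrite mem_swap_pred swapXYK.
Qed.

Lemma swap_sep_poly (f g : {poly L}) : swapXY (sep_poly g f) = - sep_poly f g.
Proof.
by rewrite rmorphB /= swapXY_polyC swapXY_map_polyC /sep_poly opprB.
Qed.

Variables (K : fieldType) (phi : {rmorphism {poly {poly L}} -> K}).

Definition swap_morph : {rmorphism {poly {poly L}} -> K} := phi \o swapXY.

Lemma swap_morph_const (c : L) : swap_morph c%:P%:P = phi c%:P%:P.
Proof. by rewrite /swap_morph /= swapXY_polyC map_polyC. Qed.

Lemma swap_morph_coordX : swap_morph (coordX L) = phi (coordY L).
Proof. by rewrite /swap_morph /= swapXY_Y. Qed.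

Lemma swap_morph_coordY : swap_morph (coordY L) = phi (coordX L).
Proof. by rewrite /swap_morph /= swapXY_X. Qed.

Lemma swap_function_field p :
  is_function_field phi p -> is_function_field swap_morph (swap_pred p).
Proof.
move=> [h1 h2]; split=> [a|z]; first by rewrite /swap_morph /= h1.
have [a [b [b0 ->]]] := h2 z; exists (swapXY a), (swapXY b).
by rewrite /swap_morph /= !swapXYK.
Qed.

Lemma swap_boundary : boundary swap_morph = boundary phi.
Proof.
apply/funext => v; apply/propext.
have pts : is_point swap_morph v <-> is_point phi v.
  split; apply: is_point_const => c; first exact: swap_morph_const.
  by rewrite swap_morph_const.
have bE : is_point phi v -> boundary swap_morph v <-> boundary phi v.
  move=> vp; rewrite (boundaryP vp) (boundaryP (pts.2 vp)).
  by rewrite swap_morph_coordX swap_morph_coordY; split=> -[]; [right|left|right|left].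
by split=> v_bd; have [h _] := v_bd; apply/bE => //; apply/pts.
Qed.

Lemma swap_map_degree x d :
  has_map_degree swap_morph x d = has_map_degree phi x d.
Proof.
rewrite /has_map_degree /rational_subfield.
suff -> : (fun c : L => swap_morph c%:P%:P) = (fun c => phi c%:P%:P) by [].
by apply/funext => c; apply: swap_morph_const.
Qed.

End Swap.

(** * Base change to the algebraic closure and conclusion *)

Lemma coprime_bezout (M N : nat) : (0 < M)%N -> (0 < N)%N -> coprime M N ->
  exists u t, (u * N = t * M + 1)%N.
Proof.
move=> M_gt0 N_gt0; rewrite coprime_sym => /eqP co; exists (egcdn N M).1, (egcdn N M).2.
by case: egcdnP => //= u t; rewrite co.
Qed.

Theorem theorem2p8 (k : fieldType) (char0 : [pchar k] =i pred0)
    (kbar : closedFieldType) (iota : {rmorphism k -> kbar})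
    (iota_alg : forall z : kbar, algebraicOver iota z)
    (f g : {poly k}) (f_nonconst : (1 < size f)%N)
    (g_nonconst : (1 < size g)%N)
    (s : nat) (C : 'I_s -> {pred {poly {poly kbar}}})
    (C_components : set_bij [set: 'I_s] (components iota f g) C)
    (K : 'I_s -> fieldType)
    (phi : forall i, {rmorphism {poly {poly kbar}} -> K i})
    (phi_function_field : forall i, is_function_field (phi i) (C i)) :
  let m := (size f).-1 in
  let n := (size g).-1 in
  let e := gcdn m n in
  let M := (m %/ e)%N in
  let N := (n %/ e)%N in
  exists d : 'I_s -> nat,
    [/\ forall i, (boundary (phi i) #= `I_(d i))%card,
        (\sum_(i < s) d i)%N = e,
        forall i (v : K i -> int), boundary (phi i) v ->
          - v (phi i (coordX kbar)) = N%:Z /\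
          - v (phi i (coordY kbar)) = M%:Z
      & forall i,
          has_map_degree (phi i) (phi i (coordX kbar)) (N * d i) /\
          has_map_degree (phi i) (phi i (coordY kbar)) (M * d i)].
Proof.
move=> m n e M N.
have m_gt0 : (0 < m)%N by rewrite /m -ltnS prednK // ltnW.
have n_gt0 : (0 < n)%N by rewrite /n -ltnS prednK // ltnW.
have e_gt0 : (0 < e)%N by rewrite gcdn_gt0 m_gt0.
have mE : (M * e = m)%N by rewrite divnK // dvdn_gcdl.
have nE : (N * e = n)%N by rewrite divnK // dvdn_gcdr.
have M_gt0 : (0 < M)%N by move: m_gt0; rewrite -mE muln_gt0 => /andP[].
have N_gt0 : (0 < N)%N by move: n_gt0; rewrite -nE muln_gt0 => /andP[].
have co : coprime M N.
  by rewrite /coprime -(eqn_pmul2r e_gt0) muln_gcdl mE nE mul1n.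
pose fL := map_poly iota f; pose gL := map_poly iota g.
have size_f : size fL = (M * e).+1 by rewrite size_map_poly mE prednK // ltnW.
have size_g : size gL = (N * e).+1 by rewrite size_map_poly nE prednK // ltnW.
have e_neq0 : e%:R != 0 :> kbar.
  by rewrite -(rmorph_nat iota) fmorph_eq0 ((pcharf0P k).1 char0) -lt0n.
have compE : components iota f g = [set p | minimal_prime (sep_poly fL gL) p].
  by apply/funext => p; apply/propext; apply: componentsE.
rewrite compE in C_components.
have swapE : set_bij [set: 'I_s] [set p | minimal_prime (sep_poly gL fL) p]
    (fun i => swap_pred (C i)).
  case: C_components => C_fun C_inj C_surj; split.
  - by move=> i _; apply: swap_minimal_prime (swap_sep_poly fL gL) (C_fun i I).
  - by move=> i j hi hj /(congr1 (@swap_pred _)); rewrite !swap_predK; apply: C_inj.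
  - move=> p pmin.
    have [i _ Ci] := C_surj _ (swap_minimal_prime (swap_sep_poly gL fL) pmin).
    by exists i => //; rewrite Ci swap_predK.
have [u [t uN]] := coprime_bezout M_gt0 N_gt0 co.
have [|u' [t' uM]] := coprime_bezout N_gt0 M_gt0 _; first by rewrite coprime_sym.
have [d [card_d sum_d ord_d degX]] := components_at_infinity uN size_f size_g
  M_gt0 N_gt0 e_neq0 C_components phi_function_field.
have [d' [card_d' _ _ degY]] := components_at_infinity uM size_g size_f
  N_gt0 M_gt0 e_neq0 swapE (fun i => swap_function_field (phi_function_field i)).
exists d; split=> // i; split=> //.
(* The swapped curve has the same boundary as a set of valuations, so both counts agree. *)
have <- : d' i = d i.
  have := card_d' i; rewrite swap_boundary => h.
  by apply/card_eq_II; rewrite -(card_eql h).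
by have := degY i; rewrite swap_morph_coordX swap_map_degree.
Qed.
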